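(* Let $d\geq 2$, let $T$ be the $d$-regular rooted tree, and let $G\leq\operatorname{Aut}(T)$ be a finitely generated self-similar branch group with the subgroup induction property. Then $G$ is subgroup separable. Suppose moreover that the intersection of all finite-index maximal subgroups of $G$ is not trivial (e.g. if $G$ is a $p$-group), and let $H$ be a finitely generated subgroup of $G$. Then all maximal subgroups of $H$ are of finite index in $H$, and all weakly maximal subgroups of $H$ are closed in the profinite topology on $H$.
   Context: The vertices of the $d$-regular rooted tree $T$ are identified with the words in $\{1,\dots,d\}^*$; the root is the empty word, the children of $v$ are $v1,\dots,vd$, and $\mathcal L_n$ is the set of words of length $n$. $\operatorname{Aut}(T)$ is the group of automorphisms of $T$ (fixing the root). For a vertex $v$, $T_v$ is the subtree of all words with prefix $v$. For $g\in\operatorname{Aut}(T)$ and a vertex $v$, the section $\varphi_v(g)\in\operatorname{Aut}(T)$ is the unique automorphism with $g\cdot(vw)=(g\cdot v)(\varphi_v(g)\cdot w)$ for all $w\in T$; $\varphi_v$ is a homomorphism on the stabilizer of $v$. For $G\leq\operatorname{Aut}(T)$ and a set $V$ of vertices, $\operatorname{Stab}_G(V)$ is the pointwise stabilizer of $V$ in $G$. $\operatorname{Rist}_G(v)$ is the subgroup of elements of $G$ acting trivially outside $T_v$, and $\operatorname{Rist}_G(\mathcal L_n)$ is the subgroup generated by all $\operatorname{Rist}_G(v)$, $v\in\mathcal L_n$. $G$ is branch if it acts transitively on every $\mathcal L_n$, all $\operatorname{Rist}_G(v)$ are infinite, and every $\operatorname{Rist}_G(\mathcal L_n)$ has finite index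 in $G$. $G$ is self-similar if $\varphi_v(G)\leq G$ for all vertices $v$. Let $G$ be self-similar. A class $\mathcal X$ of subgroups of $G$ is inductive if: (A) $\{1\}\in\mathcal X$ and $G\in\mathcal X$; (B) if $H\leq L$ are subgroups of $G$ with $[L:H]$ finite and $H\in\mathcal X$, then $L\in\mathcal X$; (C) if $H$ is a finitely generated subgroup of $\operatorname{Stab}_G(\mathcal L_1)$ and $\varphi_v(H)\in\mathcal X$ for all $v\in\mathcal L_1$, then $H\in\mathcal X$. $G$ has the subgroup induction property if every inductive class of subgroups of $G$ contains every finitely generated subgroup of $G$. A group is subgroup separable (LERF) if all of its finitely generated subgroups are closed in its profinite topology. A subgroup of a group is weakly maximal if it is maximal among the subgroups of infinite index. *)

(* Defs.v *)
From HB Require Import structures.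
From mathcomp Require Export all_boot.
From mathcomp Require Export boolp classical_sets functions cardinality.

Set Implicit Arguments.
Unset Strict Implicit.
Unset Printing Implicit Defensive.

Local Open Scope classical_set_scope.
Local Open Scope group_scope.

Section Groups.
Context {gT : groupType}.
Implicit Types (A H K L M N U C : set gT) (x y : gT).

(* Subgroups of the possibly infinite group gT are classical sets. *)
Definition subgroup H := group_closed (mem H).

Lemma subgroupP H :
  subgroup H <-> H 1 /\ (forall x y, H x -> H y -> H (x / y)).
Proof.
split=> -[H1 Hd]; split; first by move: H1; rewrite inE.
- by move=> x y Hx Hy; have := Hd x y; rewrite !in_setE; exact.
- by rewrite inE.
- by move=> x y; rewrite !in_setE; exact: Hd.
Qed.

Definition subgroup_of H K := subgroup H /\ H `<=` K.

Definition generated A : set gT := smallest subgroup A.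

Definition finitely_generated H := exists2 A, finite_set A & H = generated A.

Definition lcoset x H : set gT := [set x * h | h in H].

(* [K : H] is finite; used only for a subgroup H of a group K. *)
Definition finite_index H K := finite_set [set lcoset x H | x in K].

Definition normal_in N K := forall n x, N n -> K x -> N (n ^ x).

Definition maximal_subgroup M H :=
  [/\ subgroup_of M H, M <> H &
      forall L, subgroup_of L H -> M `<=` L -> L = M \/ L = H].

Definition weakly_maximal_subgroup M H :=
  [/\ subgroup_of M H, ~ finite_index M H &
      forall L, subgroup_of L H -> ~ finite_index L H -> M `<=` L -> L = M].

(* The cosets of the finite-index normal subgroups of K are a basis of the
   profinite topology on K. *)
Definition profinite_open K U :=
  U `<=` K /\
  forall x, U x ->
    exists N, [/\ subgroup_of N K, normal_in N K, finite_index N K &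
                  lcoset x N `<=` U].

Definition profinite_closed K C := C `<=` K /\ profinite_open K (K `\` C).

Definition subgroup_separable K :=
  forall H, subgroup_of H K -> finitely_generated H -> profinite_closed K H.

(* Equal to K itself when K has no maximal subgroup of finite index. *)
Definition finite_index_frattini K : set gT :=
  [set x | K x /\ forall M, maximal_subgroup M K -> finite_index M K -> M x].

Definition is_pgroup p K :=
  prime p /\ forall x, K x -> exists n : nat, x ^+ (p ^ n)%N = 1.

End Groups.

Section TreeAutomorphisms.
Context {d : nat}.
Implicit Types (f : seq 'I_d -> seq 'I_d) (u v w : seq 'I_d).

Definition tree_adj u v := [exists i, (v == rcons u i) || (u == rcons v i)].

Definition is_tree_aut f :=
  [/\ bijective f, f [::] = [::] & forall u v, tree_adj (f u) (f v) = tree_adj u v].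

Lemma tree_aut_rcons f u i : is_tree_aut f ->
  size (f u) = size u /\ exists j, f (rcons u i) = rcons (f u) j.
Proof.
case=> /bij_inj finj f0 fadj; elim/last_ind: u i => [|u k IH] i.
  split; first by rewrite f0.
  have : tree_adj (f [::]) (f (rcons [::] i)).
    by rewrite fadj; apply/existsP; exists i; rewrite eqxx.
  case/existsP=> j; case/orP=> /eqP E; first by exists j.
  by move/(congr1 size): E; rewrite f0 size_rcons.
have [su [j Ej]] := IH k; split; first by rewrite Ej !size_rcons su.
have : tree_adj (f (rcons u k)) (f (rcons (rcons u k) i)).
  by rewrite fadj; apply/existsP; exists i; rewrite eqxx.
case/existsP=> l; case/orP=> /eqP E; first by exists l.
move: E; rewrite Ej => /rcons_inj[E _].
by move/finj/(congr1 size): E; rewrite !size_rcons => /eqP; rewrite ltn_eqF.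
Qed.

Lemma tree_aut_size f u : is_tree_aut f -> size (f u) = size u.
Proof.
case: u => [|i u] fa; first by case: fa => _ -> _.
by have [] := tree_aut_rcons (i :: u) i fa.
Qed.

Lemma tree_aut_cat f u w : is_tree_aut f ->
  f (u ++ w) = f u ++ drop (size u) (f (u ++ w)).
Proof.
move=> fa; elim/last_ind: w => [|w i IH].
  by rewrite cats0 drop_oversize ?cats0 // (tree_aut_size _ fa).
rewrite -rcons_cat; have [_ [j ->]] := tree_aut_rcons (u ++ w) i fa.
have le_u : size u <= size (f (u ++ w)).
  by rewrite (tree_aut_size _ fa) size_cat leq_addr.
by rewrite drop_rcons // {1}IH rcons_cat.
Qed.

Lemma tree_adj_cat u v w : tree_adj (u ++ v) (u ++ w) = tree_adj v w.
Proof.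
by apply: eq_existsb => i; rewrite !rcons_cat !eqseq_cat ?eqxx.
Qed.

Lemma is_tree_aut_id : is_tree_aut id.
Proof. by split=> //; exists id. Qed.

Lemma is_tree_aut_comp f1 f2 :
  is_tree_aut f1 -> is_tree_aut f2 -> is_tree_aut (f1 \o f2).
Proof.
case=> b1 r1 a1 [b2 r2 a2]; split; first exact: bij_comp.
  by rewrite /= r2.
by move=> u v /=; rewrite a1 a2.
Qed.

Lemma is_tree_aut_can f g :
  is_tree_aut f -> cancel f g -> cancel g f -> is_tree_aut g.
Proof.
case=> b r a fg gf; split; first by exists f.
  by rewrite -[in LHS]r fg.
by move=> u v; rewrite -a !gf.
Qed.

Lemma is_tree_aut_section f v :
  is_tree_aut f -> is_tree_aut (fun w => drop (size v) (f (v ++ w))).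
Proof.
move=> fa; have [[g fg gf] f0 fadj] := fa.
have ga := is_tree_aut_can fa fg gf.
split.
- exists (fun w => drop (size v) (g (f v ++ w))) => w /=.
    by rewrite -tree_aut_cat // fg drop_size_cat.
  have := tree_aut_cat (f v) w ga; rewrite fg (tree_aut_size _ fa) => <-.
  by rewrite gf drop_size_cat // (tree_aut_size _ fa).
- by rewrite cats0 drop_oversize // (tree_aut_size _ fa).
- by move=> u w; rewrite -(tree_adj_cat (f v)) -!tree_aut_cat // fadj tree_adj_cat.
Qed.

End TreeAutomorphisms.

(* Aut(T): vertices of the d-regular rooted tree T are words over 'I_d
   (letters 0, ..., d-1 instead of 1, ..., d), the root is [::]. *)
Record tree_aut (d : nat) := TreeAut {
  tree_aut_fun :> seq 'I_d -> seq 'I_d;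
  tree_autP : is_tree_aut tree_aut_fun
}.

Section TreeAutGroup.
Context {d : nat}.
Implicit Types g h : tree_aut d.

Lemma tree_aut_ext g h : (forall w, g w = h w) -> g = h.
Proof.
case: g h => [f fP] [f' f'P] /= /funext E; subst f'.
by congr TreeAut; exact: Prop_irrelevance.
Qed.

Lemma tree_aut_inv_ex g : exists h : tree_aut d, cancel g h /\ cancel h g.
Proof.
have [[f gf fg] _ _] := tree_autP g.
by exists (TreeAut (is_tree_aut_can (tree_autP g) gf fg)).
Qed.

Definition tree_aut_one : tree_aut d := TreeAut is_tree_aut_id.
Definition tree_aut_mul g h : tree_aut d :=
  TreeAut (is_tree_aut_comp (tree_autP g) (tree_autP h)).
Definition tree_aut_inv g : tree_aut d := sval (cid (tree_aut_inv_ex g)).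

Lemma tree_aut_mulA : associative tree_aut_mul.
Proof. by move=> g h k; apply: tree_aut_ext. Qed.
Lemma tree_aut_mul1 : left_id tree_aut_one tree_aut_mul.
Proof. by move=> g; apply: tree_aut_ext. Qed.
Lemma tree_aut_mulr1 : right_id tree_aut_one tree_aut_mul.
Proof. by move=> g; apply: tree_aut_ext. Qed.
Lemma tree_aut_mulV : left_inverse tree_aut_one tree_aut_inv tree_aut_mul.
Proof.
by move=> g; apply: tree_aut_ext => w; rewrite /= /tree_aut_inv; case: cid => h [].
Qed.
Lemma tree_aut_mulrV : right_inverse tree_aut_one tree_aut_inv tree_aut_mul.
Proof.
by move=> g; apply: tree_aut_ext => w; rewrite /= /tree_aut_inv; case: cid => h [].
Qed.

HB.instance Definition _ := gen_eqMixin (tree_aut d).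
HB.instance Definition _ := gen_choiceMixin (tree_aut d).
HB.instance Definition _ := isGroup.Build (tree_aut d)
  tree_aut_mulA tree_aut_mul1 tree_aut_mulr1 tree_aut_mulV tree_aut_mulrV.

Lemma tree_aut1E w : (1 : tree_aut d) w = w. Proof. by []. Qed.
Lemma tree_autME g h w : (g * h) w = g (h w). Proof. by []. Qed.

End TreeAutGroup.

Section SelfSimilar.
Context {d : nat}.
Implicit Types (G H : set (tree_aut d)) (V : set (seq 'I_d)) (u v w : seq 'I_d).

Definition section v (g : tree_aut d) : tree_aut d :=
  TreeAut (is_tree_aut_section v (tree_autP g)).

Lemma sectionE v (g : tree_aut d) w : g (v ++ w) = g v ++ section v g w.
Proof. exact/tree_aut_cat/tree_autP. Qed.

Lemma section_uniq v (g h : tree_aut d) :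
  (forall w, g (v ++ w) = g v ++ h w) -> h = section v g.
Proof.
move=> E; apply: tree_aut_ext => w; apply/eqP.
by have := sectionE v g w; rewrite E => /eqP; rewrite eqseq_cat // eqxx.
Qed.

Definition level n : set (seq 'I_d) := [set v | size v = n].

Definition stab G V : set (tree_aut d) :=
  [set g | G g /\ forall v, V v -> g v = v].

Definition rist G v : set (tree_aut d) :=
  [set g | G g /\ forall w, ~~ prefix v w -> g w = w].

Definition rist_level G n : set (tree_aut d) :=
  generated (\bigcup_(v in level n) rist G v).

Definition level_transitive G :=
  forall n u v, level n u -> level n v -> exists2 g, G g & g u = v.

Definition branch G :=
  [/\ level_transitive G,
      forall v, infinite_set (rist G v) &
      forall n, finite_index (rist_level G n) G].

Definition self_similar G := forall v, section v @` G `<=` G.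

Definition inductive_class G (X : set (set (tree_aut d))) :=
  [/\ X `<=` [set H | subgroup_of H G],
      X [set 1] /\ X G,
      forall H L, subgroup_of H G -> subgroup_of L G -> H `<=` L ->
        finite_index H L -> X H -> X L &
      forall H, subgroup_of H (stab G (level 1)) -> finitely_generated H ->
        (forall v, level 1 v -> X (section v @` H)) -> X H].

Definition subgroup_induction G :=
  forall X, inductive_class G X ->
  forall H, subgroup_of H G -> finitely_generated H -> X H.

End SelfSimilar.

(* Main.v *)
Require Import Defs.
From mathcomp Require fingroup perm cyclic commutator pgroup sylow
  gseries abelian maximal.

Set Implicit Arguments.
Unset Strict Implicit.
Unset Printing Implicit Defensive.

Local Open Scope classical_set_scope.
Local Open Scope group_scope.

(** The proof of separability is an application of the subgroup induction
    property to the class [X] of the subgroups [H] of [G] such that every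
    normal subgroup of every finite-index subgroup of [H] is closed in the
    profinite topology of [G] (being closed is expressed by [separable]).
    Asking for all these normal subgroups, and not just for [H], is what makes
    [X] inductive; once this is known, every finitely generated subgroup lies
    in [X] and in particular is closed.

    - Finite-index overgroups: if [H] has finite index in [L] and [N] is normal
      in a finite-index subgroup of [L], then [N `&` H] is closed and [N] is a
      finite union of its cosets.

    - First-level stabilizer: a subgroup of it embeds into the product of its
      sections, so this reduces to products of two groups, the content of
      [separable_kernelI].  A normal subgroup [N] of a subdirect product [K] is
      closed because, by hypothesis, so are not only its two projections but
      also the normal subgroups which are needed to compare the topologies
      induced on the common quotient of the two projections.

    - [G] itself: this uses that [G] is just infinite and that no finite-index
      subgroup [K] of it has a nontrivial abelian normal subgroup.  If [N] is
      normal in [K] and [C] is its centralizer in [K], then [N ** C] has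
      trivial centralizer in [K], and so does the intersection of its
      conjugates under [G] when [K] is normal in [G].  Therefore this
      intersection is not trivial, and [N ** C] has finite index; now [N] is the intersection of
      the finite-index subgroup [N ** C] with the centralizer of [C], which is
      closed because [G] is residually finite ([separable_normal_subgroup]).

    That [G] is just infinite comes from a first use of subgroup induction, for
    the class of the subgroups that are finite or not virtually abelian: it
    shows that [G] is torsion ([sip_torsion]).  A nontrivial normal subgroup of
    a branch group contains the commutator subgroup of some [rist_level G n],
    which is finitely generated and has finite abelianization, as it is
    torsion ([branch_just_infinite]).

    Let now the intersection [N] of the maximal subgroups of finite index be
    nontrivial, hence of finite index.  The images of [N] in finite quotients
    of [G] lie in Frattini subgroups, where Sylow subgroups are normal, and
    with just infiniteness this makes [N] a [p]-group for a single prime [p]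
    ([frattini_pgroup]).  A finitely generated subgroup [H] of [G] thus has a
    normal finite-index [p]-subgroup [K], and the subgroup generated by the
    [p]-th powers and the commutators of [K] has finite index and lies in all
    maximal subgroups of finite index of [H].  If [M] is any maximal subgroup
    of [H], finitely many elements of [M] generate it modulo that subgroup.
    They generate a closed proper subgroup of [H], which lies in a maximal
    subgroup of finite index, and the latter contains [M]
    ([maximal_fi_of_separable]).  Weakly maximal subgroups are treated by
    applying this to their closure ([weakly_maximal_separable]). *)

(** * Subgroups of a possibly infinite group *)

Definition mulset {gT : groupType} (A B : set gT) : set gT :=
  [set x * y | x in A & y in B].

Local Notation "A ** B" := (mulset A B) (at level 40, left associativity).

Section Subgroups.
Context {gT : groupType}.
Implicit Types (A B H K L M N U V : set gT) (x y : gT) (s : seq gT).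

Lemma sg1 H : subgroup H -> H 1.
Proof. by case/subgroupP. Qed.

Lemma sgF H x y : subgroup H -> H x -> H y -> H (x / y).
Proof. by case/subgroupP=> _; apply. Qed.

Lemma sgV H x : subgroup H -> H x -> H x^-1.
Proof. by move=> sH Hx; rewrite -div1g; apply: sgF => //; apply: sg1. Qed.

Lemma sgM H x y : subgroup H -> H x -> H y -> H (x * y).
Proof. by move=> sH Hx Hy; rewrite -[y]invgK; apply: sgF => //; apply: sgV. Qed.

Lemma sgJ H x y : subgroup H -> H x -> H y -> H (x ^ y).
Proof. by move=> sH Hx Hy; apply: sgM; [|apply: sgV|apply: sgM]. Qed.

Lemma sgR H x y : subgroup H -> H x -> H y -> H [~ x, y].
Proof. by move=> sH Hx Hy; apply: sgM; [|apply: sgV|apply: sgJ]. Qed.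

Lemma sgX H x n : subgroup H -> H x -> H (x ^+ n).
Proof.
move=> sH Hx; elim: n => [|n IHn]; first exact: sg1.
by rewrite expgS; apply: sgM.
Qed.

Lemma sgMr H x y : subgroup H -> H y -> H (x * y) -> H x.
Proof. by move=> sH Hy Hxy; rewrite -[x](mulgK y); apply: sgF. Qed.

Lemma sgI H K : subgroup H -> subgroup K -> subgroup (H `&` K).
Proof.
move=> sH sK; apply/subgroupP; split; first by split; apply: sg1.
by move=> x y [Hx Kx] [Hy Ky]; split; apply: sgF.
Qed.

Lemma sg_set1 : subgroup [set 1 : gT].
Proof. by apply/subgroupP; split=> // x y -> ->; rewrite /= !gnorm. Qed.

Lemma subgroup_of_refl H : subgroup H -> subgroup_of H H.
Proof. by split. Qed.

Lemma gen_subgroup A : subgroup (generated A).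
Proof.
apply/subgroupP; split=> [B [sB _]|x y Ax Ay B BP]; first exact: sg1.
by case: (BP) => sB AB; apply: sgF => //; [apply: Ax | apply: Ay].
Qed.

Lemma gen_sub A : A `<=` generated A.
Proof. exact: sub_gen_smallest. Qed.

Lemma gen_min A H : subgroup H -> A `<=` H -> generated A `<=` H.
Proof. exact: smallest_sub. Qed.

Lemma gen_normal A K : (forall a x, A a -> K x -> A (a ^ x)) ->
  normal_in (generated A) K.
Proof.
move=> nA a x gAa Kx.
suff H : generated A `<=` [set b | generated A (b ^ x)] by apply: H.
have sg := gen_subgroup A.
apply: gen_min => [|b Ab]; last exact: (gen_sub (nA b x Ab Kx)).
apply/subgroupP; split=> [|b c /= gb gc]; first by rewrite /= conj1g; apply: sg1.
by rewrite /= conjMg conjVg; exact: (sgF sg).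
Qed.

Lemma normalI N M K : normal_in N K -> normal_in M K -> normal_in (N `&` M) K.
Proof. by move=> nN nM x k [Nx Mx] Kk; split; [apply: nN | apply: nM]. Qed.

Lemma normalS N H K : H `<=` K -> normal_in N K -> normal_in N H.
Proof. by move=> HK nN x h Nx /HK; apply: nN. Qed.

Lemma normal_self H : subgroup H -> normal_in H H.
Proof. by move=> sH x y Hx Hy; apply: sgJ. Qed.

Lemma mulset_l A B : B 1 -> A `<=` A ** B.
Proof. by move=> B1 x Ax; exists x => //; exists 1 => //; rewrite mulg1. Qed.

Lemma mulset_r A B : A 1 -> B `<=` A ** B.
Proof. by move=> A1 x Bx; exists 1 => //; exists x => //; rewrite mul1g. Qed.

Lemma mulset_subgroup A B :
  subgroup A -> subgroup B -> normal_in B A -> subgroup (A ** B).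
Proof.
move=> sA sB nB; apply/subgroupP; split.
  by apply: mulset_l; apply: sg1.
move=> _ _ [a Aa [b Bb <-]] [c Ac [e Be <-]].
exists (a / c); first exact: sgF.
exists ((b / e) ^ c^-1); last by rewrite /conjg !gnorm.
by apply: nB; [apply: sgF | apply: sgV].
Qed.

Lemma mulset_sub A B H : subgroup H -> A `<=` H -> B `<=` H -> A ** B `<=` H.
Proof. by move=> sH AH BH _ [a /AH Ha [b /BH Hb <-]]; apply: sgM. Qed.

Lemma mulset_normal A B K : normal_in A K -> normal_in B K -> normal_in (A ** B) K.
Proof.
move=> nA nB _ k [a Aa [b Bb <-]] Kk; exists (a ^ k); first exact: nA.
by exists (b ^ k); [apply: nB | rewrite conjMg].
Qed.

(** The elements of [K] whose images modulo [L] centralize that of [N]. *)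
Lemma relative_centralizer_subgroup N K L : subgroup L -> subgroup K ->
  normal_in L K -> N `<=` K ->
  subgroup [set x | K x /\ forall y, N y -> L [~ x, y]].
Proof.
move=> sL sK nL NK; apply/subgroupP; split.
  by split=> [|y Ny]; [apply: sg1 | rewrite comm1g; apply: sg1].
move=> x z [Kx cx] [Kz cz]; split=> [|y Ny]; first exact: sgF.
have -> : [~ x / z, y] = ([~ x, y] / [~ z, y]) ^ z^-1.
  by rewrite /commg /conjg !gnorm.
by apply: nL; [apply: sgF; [|apply: cx|apply: cz] | apply: sgV].
Qed.

(** * Finite index *)

Lemma lcoset_mem x H z : lcoset x H z <-> H (x^-1 * z).
Proof.
split=> [[h Hh <-]|Hz]; first by rewrite mulKg.
by exists (x^-1 * z) => //; rewrite mulVKg.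
Qed.

Lemma eq_lcoset x y H : subgroup H -> lcoset x H = lcoset y H <-> H (x^-1 * y).
Proof.
move=> sH; split=> [E|Hxy].
  by apply/lcoset_mem; rewrite E; apply/lcoset_mem; rewrite mulVg; apply: sg1.
apply/seteqP; split=> z /lcoset_mem Hz; apply/lcoset_mem.
  have -> : y^-1 * z = (x^-1 * y)^-1 * (x^-1 * z) by rewrite !gnorm.
  by apply: sgM => //; apply: sgV.
by rewrite -[z](mulVKg y) mulgA; apply: sgM.
Qed.

(** A function on [K] which separates the cosets of [H] bounds their number:
    this gives finite index without naming representatives. *)
Lemma fi_fun (U : Type) (f : gT -> U) H K : subgroup H -> finite_set (f @` K) ->
  (forall x y, K x -> K y -> f x = f y -> H (x^-1 * y)) -> finite_index H K.
Proof.
move=> sH finf fP.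
pose g u : set gT := [set z | exists2 x, K x /\ f x = u & lcoset x H z].
apply: sub_finite_set (finite_image g finf) => _ [x Kx <-].
exists (f x); first by exists x.
apply/seteqP; split=> z; last by exists x.
case=> y [Ky Ef] yz; suff -> : lcoset x H = lcoset y H by [].
by apply/eq_lcoset => //; apply: fP.
Qed.

Lemma fi_of_reps H K s : subgroup H ->
  (forall x, K x -> exists2 t, t \in s & H (t^-1 * x)) -> finite_index H K.
Proof.
move=> sH sP; apply: sub_finite_set (finite_image (lcoset^~ H) (finite_seq s)).
move=> _ [x Kx <-]; have [t st Ht] := sP x Kx.
by exists t => //; apply/eq_lcoset.
Qed.

Lemma fi_reps H K : subgroup H -> finite_index H K ->
  exists2 s : seq gT, (forall t, t \in s -> K t) &
    forall x, K x -> exists2 t, t \in s & H (t^-1 * x).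
Proof.
move=> sH fHK; pose rep (C : set gT) := xget 1 (C `&` K).
have /finite_seqP[s Es] := finite_image rep fHK.
have repP x : K x -> (lcoset x H `&` K) (rep (lcoset x H)).
  move=> Kx; apply: xgetPex; exists x; split=> //.
  by apply/lcoset_mem; rewrite mulVg; apply: sg1.
have sP t : t \in s <-> [set` s] t by [].
exists s => [t|x Kx].
  by move/sP; rewrite -Es => -[_ [x Kx <-] <-]; have [] := repP x Kx.
exists (rep (lcoset x H)); first by apply/sP; rewrite -Es; exists (lcoset x H) => //; exists x.
have [/lcoset_mem Hx _] := repP x Kx.
by rewrite -[_ * x]invgK invgM invgK; apply: sgV.
Qed.

Lemma fi_mono H K L : L `<=` K -> finite_index H K -> finite_index H L.
Proof. by move=> LK; apply: sub_finite_set => _ [x /LK Kx <-]; exists x. Qed.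

Lemma fi_refl K : subgroup K -> finite_index K K.
Proof.
move=> sK; apply: (@fi_of_reps _ _ [:: 1]) => // x Kx.
by exists 1; rewrite ?mem_head // invg1 mul1g.
Qed.

Lemma fi_setI H L K : subgroup H -> subgroup L ->
  finite_index H K -> finite_index L K -> finite_index (H `&` L) K.
Proof.
move=> sH sL fH fL; pose f x := (lcoset x H, lcoset x L).
apply: (@fi_fun _ f); first exact: sgI.
  apply: sub_finite_set (finite_setX fH fL) => _ [x Kx <-].
  by split; exists x.
by move=> x y Kx Ky [/eq_lcoset Hxy /eq_lcoset Lxy]; split; [apply: Hxy|apply: Lxy].
Qed.

Lemma fi_sup H L K : subgroup H -> subgroup L -> H `<=` L ->
  finite_index H K -> finite_index L K.
Proof.
move=> sH sL HL /(fi_reps sH)[s _ sP]; apply: (fi_of_reps (s := s)) => // x Kx.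
by have [t st /HL] := sP x Kx; exists t.
Qed.

Lemma fi_trans M H K : subgroup M -> subgroup H ->
  finite_index M H -> finite_index H K -> finite_index M K.
Proof.
move=> sM sH /(fi_reps sM)[s _ sP] /(fi_reps sH)[r _ rP].
apply: (fi_of_reps (s := [seq t * u | t <- r, u <- s])) => // x Kx.
have [t rt /sP[u su Mu]] := rP x Kx.
by exists (t * u); [apply: allpairs_f | rewrite invgM -mulgA].
Qed.

Lemma fi_bigI (I : eqType) (r : seq I) (F : I -> set gT) K : subgroup K ->
  (forall i, i \in r -> subgroup (F i) /\ finite_index (F i) K) ->
  let D := [set x | K x /\ forall i, i \in r -> F i x] in
  subgroup D /\ finite_index D K.
Proof.
move=> sK; elim: r => [|i r IHr] Fr /=.
  have -> : [set x | K x /\ forall i, i \in [::] -> F i x] = K.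
    by apply/seteqP; split=> x => [[]|].
  by split=> //; apply: fi_refl.
have [|sD fD] := IHr; first by move=> j rj; apply: Fr; rewrite in_cons rj orbT.
have [sF fF] := Fr i (mem_head i r).
have -> : [set x | K x /\ forall j, j \in i :: r -> F j x] =
          F i `&` [set x | K x /\ forall j, j \in r -> F j x].
  apply/seteqP; split=> x.
    case=> Kx Fx; split; first by apply: Fx; rewrite mem_head.
    by split=> // j rj; apply: Fx; rewrite in_cons rj orbT.
  by case=> Fx [Kx Frx]; split=> // j; rewrite in_cons => /orP[/eqP->|/Frx].
by split; [exact: sgI | exact: fi_setI].
Qed.

Lemma fi_conj H K t : subgroup H -> subgroup K -> K t -> finite_index H K ->
  subgroup [set x | H (x ^ t)] /\ finite_index [set x | H (x ^ t)] K.
Proof.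
move=> sH sK Kt fH.
have sHt : subgroup [set x | H (x ^ t)].
  apply/subgroupP; split=> [|x y Hx Hy]; first by rewrite /= conj1g; apply: sg1.
  by rewrite /= conjMg conjVg; apply: sgF.
split=> //; apply: (@fi_fun _ (fun x => lcoset (x ^ t) H)) => //.
  by apply: sub_finite_set fH => _ [x Kx <-]; exists (x ^ t) => //; apply: sgJ.
by move=> x y Kx Ky /eq_lcoset => /(_ sH); rewrite /= conjMg conjVg.
Qed.

Lemma fi_core V K : subgroup V -> subgroup K -> finite_index V K ->
  exists N, [/\ subgroup_of N K, normal_in N K, finite_index N K & N `<=` V].
Proof.
move=> sV sK fV; have [s sK' sP] := fi_reps sV fV.
have [|sD fD] := @fi_bigI gT s (fun t => [set x | V (x ^ t)]) K sK.
  by move=> t /sK' Kt; apply: fi_conj.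
set D := (D in finite_index D K) in sD fD.
have DP x k : D x -> K k -> V (x ^ k).
  move=> [Kx Dx] Kk; have [t st Vt] := sP k Kk.
  rewrite -[k](mulVKg t) conjgM; apply: sgJ => //; exact: Dx.
exists D; split=> //.
- by split=> // x [].
- move=> x k Dx Kk; split=> [|t /sK' Kt]; first by apply: sgJ => //; case: Dx.
  by rewrite /= -conjgM; apply: DP => //; apply: sgM.
- by move=> x /DP/(_ (sg1 sK)); rewrite conjg1.
Qed.

Lemma fi_finite K : subgroup K -> finite_index [set 1] K <-> finite_set K.
Proof.
move=> sK; split=> [fK|fK].
  have [s _ sP] := fi_reps sg_set1 fK.
  apply: sub_finite_set (finite_seq s) => x /sP[t st /= E].
  by rewrite -[x](mulVKg t) E mulg1.
apply: (@fi_fun _ id); [exact: sg_set1 | by rewrite image_id |].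
by move=> x y _ _ ->; rewrite /= mulVg.
Qed.

(** Schreier's lemma.  Let [S] consist of [1] and of representatives of the
    left cosets of [K] in [H].  If [U] is the subgroup generated by [K `&` S]
    and the elements of [K] of the form [u^-1 * (a * t)], where [t] and [u] are
    in [S] and [a] is a generator of [H] or the inverse of one, then the union
    [W] of the cosets [t U], for [t] in [S], is stable under the generators of
    [H], so it is [H]. *)
Lemma fg_finite_index H K : subgroup_of K H -> finitely_generated H ->
  finite_index K H -> finitely_generated K.
Proof.
move=> [sK KH] [A finA EH] fK.
have sH : subgroup H by rewrite EH; apply: gen_subgroup.
have [s sH' sP] := fi_reps sK fK.
pose S : set gT := [set` 1 :: s]; pose A' : set gT := A `|` [set x^-1 | x in A].
have finS : finite_set S by apply: finite_seq.
have finA' : finite_set A' by rewrite finite_setU; split=> //; apply: finite_image.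
pose B : set gT :=
  [set y^-1 * x | y in S & x in [set x * y | x in A' & y in S]] `|` S.
have finB : finite_set (B `&` K).
  apply: finite_setIl; rewrite finite_setU; split=> //.
  by do 2!apply: finite_image2 => //.
have S1 : S 1 by rewrite /S /= mem_head.
have SP x : H x -> exists2 t, S t & K (t^-1 * x).
  by move=> /sP[t st Kt]; exists t => //; rewrite /S /= in_cons st orbT.
have A'V x : A' x -> A' x^-1.
  by case=> [Ax|[y Ay <-]]; [right; exists x | left; rewrite invgK].
have A'H x : A' x -> H x.
  have AH y : A y -> H y by rewrite EH; exact: gen_sub.
  by case=> [/AH//|[y /AH Hy <-]]; exact: sgV.
have SH t : S t -> H t.
  by rewrite /S /= in_cons => /orP[/eqP->|/sH'//]; apply: sg1.
set U := generated (B `&` K).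
have sU : subgroup U by apply: gen_subgroup.
have UK : U `<=` K by apply: gen_min => // x [].
exists (B `&` K) => //; apply/seteqP; split=> //.
pose W := [set x | exists2 t, S t & U (t^-1 * x)].
have WA a x : A' a -> W x -> W (a * x).
  move=> Aa [t St Ut]; have [|u Su Ku] := SP (a * t).
    by apply: sgM; [|apply: A'H|apply: SH].
  exists u => //.
  have -> : u^-1 * (a * x) = u^-1 * (a * t) * (t^-1 * x) by rewrite !gnorm.
  apply: (sgM sU) => //; apply: gen_sub; split=> //.
  by left; exists u => //; exists (a * t) => //; exists a => //; exists t.
have HW : H `<=` W.
  pose Z := [set x | forall y, W y -> W (x * y) /\ W (x^-1 * y)].
  have HZ : H `<=` Z.
    rewrite EH; apply: gen_min => [|a Aa y Wy].
      apply/subgroupP; split=> [y|x y Zx Zy z Wz]; first by rewrite invg1 mul1g.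
      rewrite invgM invgK -!mulgA; split.
        by have [_ /Zx[]] := Zy z Wz.
      by have [_ /Zy[]] := Zx z Wz.
    by split; apply: WA => //; [left | right; exists a].
  move=> x /HZ/(_ 1)[|]; rewrite ?mulg1 //.
  by exists 1 => //; rewrite invg1 mul1g; apply: sg1.
move=> x Kx; have [t St Ut] := HW x (KH x Kx).
rewrite -[x](mulVKg t); apply: (sgM sU) => //; apply: gen_sub; split; first by right.
by apply: (sgMr sK (UK _ Ut)); rewrite mulVKg.
Qed.

End Subgroups.

Section Homomorphisms.
Context {gT rT : groupType}.
Implicit Types (H K V : set gT) (G : set rT) (f : gT -> rT).

Definition hom_on K f := forall x y, K x -> K y -> f (x * y) = f x * f y.

Lemma hom_onS H K f : H `<=` K -> hom_on K f -> hom_on H f.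
Proof. by move=> HK fM x y /HK Kx /HK; apply: fM. Qed.

Variables (K : set gT) (f : gT -> rT) (sK : subgroup K) (fM : hom_on K f).

Lemma hom_on1 : f 1 = 1.
Proof. by apply: (mulIg (f 1)); rewrite -fM ?mulg1 ?mul1g //; apply: sg1. Qed.

Lemma hom_onV x : K x -> f x^-1 = (f x)^-1.
Proof.
move=> Kx; apply: (mulIg (f x)); rewrite -fM //; last exact: sgV.
by rewrite !mulVg hom_on1.
Qed.

Lemma hom_onF x y : K x -> K y -> f (x / y) = f x / f y.
Proof. by move=> Kx Ky; rewrite fM ?hom_onV //; apply: sgV. Qed.

Lemma hom_onVM x y : K x -> K y -> f (x^-1 * y) = (f x)^-1 * f y.
Proof. by move=> Kx Ky; rewrite fM ?hom_onV //; apply: sgV. Qed.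

Lemma hom_onJ x y : K x -> K y -> f (x ^ y) = f x ^ f y.
Proof.
move=> Kx Ky; rewrite /conjg !fM ?hom_onV //; first exact: sgV.
exact: sgM.
Qed.

Lemma hom_onX x n : K x -> f (x ^+ n) = f x ^+ n.
Proof.
move=> Kx; elim: n => [|n IHn]; first exact: hom_on1.
by rewrite !expgS fM ?IHn //; apply: sgX.
Qed.

Lemma hom_image_subgroup H : subgroup_of H K -> subgroup (f @` H).
Proof.
case=> sH HK; apply/subgroupP; split; first by exists 1; [apply: sg1|apply: hom_on1].
move=> _ _ [x Hx <-] [y Hy <-]; exists (x / y); first exact: sgF.
by rewrite hom_onF //; apply: HK.
Qed.

Lemma hom_image_normal N H : N `<=` K -> H `<=` K ->
  normal_in N H -> normal_in (f @` N) (f @` H).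
Proof.
move=> NK HK nN _ _ [x Nx <-] [y Hy <-]; exists (x ^ y); first exact: nN.
by rewrite hom_onJ //; [apply: NK | apply: HK].
Qed.

Lemma hom_preim_subgroup G : subgroup G -> subgroup [set x | K x /\ G (f x)].
Proof.
move=> sG; apply/subgroupP; split=> [|x y [Kx Gx] [Ky Gy]].
  by split; [apply: sg1 | rewrite hom_on1; apply: sg1].
by split; [apply: sgF | rewrite hom_onF //; apply: sgF].
Qed.

Lemma fi_image H L : subgroup_of H K -> L `<=` K -> 
  finite_index H L -> finite_index (f @` H) (f @` L).
Proof.
move=> [sH HK] LK fH; have [s sL sP] := fi_reps sH fH.
apply: (fi_of_reps (s := map f s)); first exact: hom_image_subgroup.
move=> _ [x Lx <-]; have [t st Ht] := sP x Lx; exists (f t); first exact: map_f.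
by exists (t^-1 * x) => //; rewrite hom_onVM //; apply: LK => //; apply: sL.
Qed.

Lemma fi_preim (V G : set rT) : subgroup V -> f @` K `<=` G -> finite_index V G ->
  finite_index [set x | K x /\ V (f x)] K.
Proof.
move=> sV KG fV; apply: (@fi_fun _ _ (fun x => lcoset (f x) V)).
- exact: hom_preim_subgroup.
- by apply: sub_finite_set fV => _ [x Kx <-]; exists (f x) => //; apply: KG; exists x.
- move=> x y Kx Ky /eq_lcoset => /(_ sV) Vxy; split; last by rewrite hom_onVM.
  by apply: sgM => //; apply: sgV.
Qed.

End Homomorphisms.

(** * Separable subgroups *)

Section Separable.
Context {gT : groupType}.
Implicit Types (A B C D E G H K L M N V : set gT) (x y g : gT).

(** For a subgroup [C], being an intersection of finite-index subgroups is
    being closed in the profinite topology; no normality is demanded here, so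
    that the notion passes at once between a group and its finite-index
    subgroups. *)
Definition separable G C := forall g, G g -> ~ C g ->
  exists V, [/\ subgroup_of V G, finite_index V G, C `<=` V & ~ V g].

Lemma separable_normal G C g : subgroup G -> subgroup C -> separable G C ->
  G g -> ~ C g -> exists N, [/\ subgroup_of N G, normal_in N G,
    finite_index N G & ~ (C ** N) g].
Proof.
move=> sG sC sepC Gg nCg; have [V [[sV VG] fV CV nVg]] := sepC g Gg nCg.
have [N [sN nN fN NV]] := fi_core sV sG fV.
by exists N; split=> //; apply: contra_not nVg; apply: mulset_sub.
Qed.

Lemma separable_of_normal G C : subgroup G -> subgroup_of C G ->
  (forall g, G g -> ~ C g -> exists N, [/\ subgroup_of N G, normal_in N G,
     finite_index N G & ~ (C ** N) g]) -> separable G C.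
Proof.
move=> sG [sC CG] sepC g Gg nCg; have [N [[sN NG] nN fN nCNg]] := sepC g Gg nCg.
exists (C ** N); split=> //.
- split; last exact: mulset_sub.
  by apply: mulset_subgroup => //; apply: normalS nN.
- apply: (fi_sup sN _ _ fN); last by apply: mulset_r; apply: sg1.
  by apply: mulset_subgroup => //; apply: normalS nN.
- by apply: mulset_l; apply: sg1.
Qed.

Lemma separable_closed G C : subgroup G -> subgroup_of C G -> separable G C ->
  profinite_closed G C.
Proof.
move=> sG [sC CG] sepC; split=> //; split=> [x []//|x [Gx nCx]].
have [N [[sN NG] nN fN nCN]] := separable_normal sG sC sepC Gx nCx.
exists N; split=> // _ [n Nn <-]; split; first by apply: sgM => //; apply: NG.
apply: contra_not nCN => Cxn; exists (x * n) => //; exists n^-1; first exact: sgV.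
exact: mulgK.
Qed.

Lemma separable_finite_index G V : subgroup_of V G -> finite_index V G ->
  separable G V.
Proof. by move=> sV fV g _ nVg; exists V; split. Qed.

Lemma separableI G C D : separable G C -> separable G D -> separable G (C `&` D).
Proof.
move=> sepC sepD g Gg nCDg; have [Cg|nCg] := pselect (C g).
  have [|V [sV fV DV nVg]] := sepD g Gg; first by move=> Dg; apply: nCDg.
  by exists V; split=> // x [_ /DV].
have [V [sV fV CV nVg]] := sepC g Gg nCg.
by exists V; split=> // x [/CV].
Qed.

Lemma separable_trans G H C : subgroup_of H G -> finite_index H G -> C `<=` H ->
  separable H C -> separable G C.
Proof.
move=> [sH HG] fH CH sepC g Gg nCg; have [Hg|nHg] := pselect (H g).
  have [V [[sV VH] fV CV nVg]] := sepC g Hg nCg.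
  exists V; split=> //; last exact: fi_trans fH.
  by split=> // x /VH/HG.
by exists H.
Qed.

Lemma separable_restrict G H C : subgroup_of H G -> C `<=` H ->
  separable G C -> separable H C.
Proof.
move=> [sH HG] CH sepC g Hg nCg; have [V [[sV VG] fV CV nVg]] := sepC g (HG g Hg) nCg.
exists (V `&` H); split.
- by split; [apply: sgI | move=> x []].
- apply: fi_setI => //; last exact: fi_refl.
  exact: fi_mono fV.
- by move=> x Cx; split; [apply: CV | apply: CH].
- by case.
Qed.

(** [D] is a finite union of cosets of [C]; an element outside of [D] is kept
    away from each of them by a finite-index subgroup. *)
Lemma separable_sup G C D : subgroup G -> subgroup C -> subgroup_of D G ->
  C `<=` D -> finite_index C D -> separable G C -> separable G D.
Proof.
move=> sG sC [sD DG] CD fC sepC; apply: separable_of_normal => // g Gg nDg.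
have [s sD' sP] := fi_reps sC fC.
pose apart t V := [/\ subgroup V, finite_index V G, C `<=` V & ~ V (t^-1 * g)].
have sepP t : t \in s -> exists V, apart t V.
  move=> /sD' Dt; have [||V [[sV _] fV CV nV]] := sepC (t^-1 * g).
  - by apply: sgM => //; apply: sgV => //; apply: DG.
  - by move=> /CD Dtg; apply: nDg; rewrite -[g](mulVKg t); apply: sgM.
  by exists V.
pose F t := xget setT [set V | apart t V].
have FP t : t \in s -> apart t (F t).
  by move=> /sepP; apply: xgetPex.
have [|sI fI] := @fi_bigI gT gT s F G sG; first by move=> t /FP[].
have [N [[sN NG] nN fN NI]] := fi_core sI sG fI.
exists N; split=> // -[x Dx [n Nn xn]]; have [t st Ct] := sP x Dx.
have [sF _ CF] := FP t st; apply; have [_ /(_ t st) Fn] := NI n Nn.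
by rewrite -xn mulgA; apply: sgM => //; apply: CF.
Qed.

(** An element [g] that does not commute with [y] is separated from the
    centralizer by the centralizer of [y] modulo a finite-index normal subgroup
    which misses [[~ g, y]]. *)
Lemma separable_centralizer G Y : subgroup G -> Y `<=` G -> separable G [set 1] ->
  separable G [set x | G x /\ forall y, Y y -> commute x y].
Proof.
move=> sG YG sep1 g Gg nCg.
have [y [Yy ncy]] : exists y, Y y /\ ~ commute g y.
  apply: contra_notP nCg => nE; split=> // y Yy.
  by apply: contra_notP nE => ncy; exists y.
have Gy := YG y Yy.
have [||N [[sN NG] nN fN nNgy]] := @separable_normal G [set 1] [~ g, y] sG sg_set1 sep1.
- exact: sgR.
- by move=> /eqP/commgP.
have E := relative_centralizer_subgroup sN sG nN (N := [set y]).
set V := [set x | _] in E.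
have sV : subgroup V by apply: E => z ->.
exists V; split=> //.
- by split=> // x [].
- apply: (fi_sup sN sV _ fN) => n Nn; split=> [|_ ->]; first exact: NG.
  by apply: sgM; [|apply: sgV|apply: nN].
- move=> x [Gx cx]; split=> // _ ->.
  by rewrite (_ : [~ x, y] = 1); [apply: sg1 | apply/eqP/commgP; apply: cx].
- case=> _ /(_ y erefl) Ngy; apply: nNgy; exists 1 => //; exists [~ g, y] => //.
  exact: mul1g.
Qed.

(** The two-coordinate case of the induction step.  Think of [A] and [B] as
    the kernels of two homomorphisms on [G], so that [A `&` B] is the kernel
    of their product [p].  Knowing that all [K]-normal subgroups of [K] have
    separable images under both coordinates gives the same for [p].  The
    difficulty is that the image of [N] in the product is a fibre product:
    the two coordinates of [N] share a common quotient, and the topologies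
    which it gets from both sides need to be compared.  The subgroup [E]
    below, which comes from an open subgroup on the side of [B], is again
    normal in [K]; hence its image on the side of [A] is separable, so open. *)
Lemma separable_kernelI G A B K : subgroup G ->
  subgroup_of A G -> normal_in A G -> subgroup_of B G -> normal_in B G ->
  subgroup_of K G ->
  (forall N, subgroup_of N K -> normal_in N K -> separable G (N ** A)) ->
  (forall N, subgroup_of N K -> normal_in N K -> separable G (N ** B)) ->
  forall N, subgroup_of N K -> normal_in N K -> separable G (N ** (A `&` B)).
Proof.
move=> sG [sA AG] nA [sB BG] nB [sK KG] sepA sepB N [sN NK] nN.
have NG : N `<=` G by move=> x /NK/KG.
have sAB := sgI sA sB; have nAB := normalI nA nB.
have sNAB : subgroup (N ** (A `&` B)).
  by apply: mulset_subgroup => //; apply: normalS nAB.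
apply: separable_of_normal => //.
  by split=> //; apply: mulset_sub => // x [/AG].
move=> g Gg nNABg.
have sNA : subgroup (N ** A) by apply: mulset_subgroup => //; apply: normalS nA.
have [[n Nn [a Aa nag]]|nNAg] := pselect ((N ** A) g); last first.
  have [V [sV nV fV nVg]] := separable_normal sG sNA (sepA N (conj sN NK) nN) Gg nNAg.
  exists V; split=> //; apply: contra_not nVg => -[_ [m Nm [c [Ac _] <-]] [v Vv <-]].
  by exists (m * c); [exists m => //; exists c | exists v].
pose M := N `&` A.
have sM : subgroup M by apply: sgI.
have nM : normal_in M K by apply: normalI => //; apply: normalS nA.
have MK : M `<=` K by move=> x [/NK].
have MG : M `<=` G by move=> x [/NG].
have sMB : subgroup (M ** B) by apply: mulset_subgroup => //; apply: normalS nB.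
have nMBa : ~ (M ** B) a.
  move=> [m [Nm Am] [b Bb mba]]; apply: nNABg; exists (n * m); first exact: sgM.
  exists b; last by rewrite -nag -mba mulgA.
  by split=> //; rewrite -[b](mulKg m) mba; apply: sgM => //; apply: sgV.
have [L [[sL LG] nL fL nMBLa]] :=
  separable_normal sG sMB (sepB M (conj sM MK) nM) (AG a Aa) nMBa.
have MBG : M ** B `<=` G by apply: mulset_sub.
have sMBL : subgroup (M ** B ** L) by apply: mulset_subgroup => //; apply: normalS nL.
have nMBL : normal_in (M ** B ** L) K.
  apply: mulset_normal; last exact: normalS nL.
  by apply: mulset_normal => //; apply: normalS nB.
pose E := N `&` (M ** B ** L).
have sE : subgroup E by apply: sgI.
have EK : E `<=` K by move=> x [/NK].
have nE : normal_in E K by apply: normalI.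
have ME : M `<=` E.
  move=> x Mx; split; first by case: Mx.
  by apply: mulset_l (sg1 sL) _ _; apply: mulset_l (sg1 sB) _ _.
have sepE := sepA E (conj sE EK) nE.
have EG : E `<=` G by move=> x /EK/KG.
have sEA : subgroup (E ** A) by apply: mulset_subgroup => //; apply: normalS nA.
have fE : finite_index E N.
  apply: (fi_setI sN sMBL); first exact: fi_refl.
  apply: fi_sup sL sMBL _ (fi_mono NG fL).
  by apply: mulset_r; apply: sg1 sMB.
(* As [E ** A] is separable and of finite index in [N ** A], some open
   subgroup of [G] meets [N ** A] within [E ** A]. *)
have [L' [[sL' L'G] nL' fL' L'E]] : exists L', [/\ subgroup_of L' G,
    normal_in L' G, finite_index L' G & (N ** A) `&` L' `<=` E ** A].
  have [s sN' sP] := fi_reps sE fE.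
  pose good t (V : set gT) := [/\ subgroup V, finite_index V G,
    E ** A `<=` V & (E ** A) t \/ ~ V t].
  pose F t := xget setT [set V | good t V].
  have FP t : t \in s -> good t (F t).
    move=> /sN' Nt; apply: xgetPex.
    have [EAt|nEAt] := pselect ((E ** A) t).
      exists G; split=> //; [exact: fi_refl | exact: mulset_sub | by left].
    by have [|V [[sV _] fV EV nVt]] := sepE t _ nEAt; [apply: NG | exists V; split=> //; right].
  have [|sI fI] := @fi_bigI gT gT s F G sG; first by move=> t /FP[].
  have [L' [sL' nL' fL' L'I]] := fi_core sI sG fI.
  exists L'; split=> // x [[m Nm [c Ac <-]] L'x].
  have [t st Et] := sP m Nm; have [sF _ EF EAt] := FP t st.
  have EAtx : (E ** A) (t^-1 * (m * c)) by exists (t^-1 * m) => //; exists c; rewrite ?mulgA.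
  have Ft : F t t.
    have [_ FI] := L'I _ L'x.
    by have := sgF sF (FI t st) (EF _ EAtx); rewrite !gnorm.
  case: EAt => // {}EAt.
  by rewrite -[m * c](mulVKg t); apply: (sgM sEA).
exists (L `&` L'); split.
- by split; [apply: sgI | move=> x [/LG]].
- exact: normalI.
- exact: fi_setI.
move=> [_ [n' Nn' [c [Ac Bc] <-]] [l [Ll L'l] E1]].
pose m := n^-1 * n'.
have Nm : N m by apply: sgM => //; apply: sgV.
have Ea : a = m * c * l.
  by rewrite -[a](mulKg n) nag -E1 /m !gnorm.
have NAl : (N ** A) l.
  have -> : l = (m * c)^-1 * a by rewrite Ea mulKg.
  apply: (sgM sNA); last exact: mulset_r (sg1 sN) _ Aa.
  by apply: (sgV sNA); exists m => //; exists c.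
have [e Ee [b Ab Eb]] := L'E l (conj NAl L'l).
have Ame : A (m * e).
  have -> : m * e = a / b / c ^ e by rewrite Ea -Eb /conjg !gnorm.
  by apply: sgF => //; [apply: sgF | apply: nA => //; apply: EG].
have Em : E m.
  by rewrite -[m](mulgK e); apply: sgF => //; apply: ME; split=> //; apply: sgM => //; case: Ee.
apply: nMBLa; rewrite Ea; apply: (sgM sMBL); last exact: mulset_r (sg1 sMB) _ Ll.
apply: (sgM sMBL); first by case: Em.
by apply: mulset_l (sg1 sL) _ _; apply: mulset_r (sg1 sM) _ _.
Qed.

End Separable.

Lemma separable_preim (gT rT : groupType) (K : set gT) (f : gT -> rT) (P C : set rT) :
  subgroup K -> hom_on K f -> f @` K `<=` P -> separable P C ->
  separable K [set x | K x /\ C (f x)].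
Proof.
move=> sK fM KG sepC g Kg nCg.
have [|| V [[sV VG] fV CV nVg]] := sepC (f g).
- by apply: KG; exists g.
- by move=> Cg; apply: nCg.
exists [set x | K x /\ V (f x)]; split.
- by split=> [|x []//]; apply: hom_preim_subgroup.
- exact: fi_preim fV.
- by move=> x [Kx Cx]; split=> //; apply: CV.
- by case.
Qed.

(** * Normal subgroups of just infinite groups *)

Section JustInfinite.
Context {gT : groupType}.
Implicit Types (A D G H K L N : set gT) (x y g : gT).

Definition centralizer K N : set gT := [set x | K x /\ forall y, N y -> commute x y].

Definition abelian_set A := forall x y, A x -> A y -> commute x y.

Definition no_abelian_normal K := forall A, subgroup_of A K -> normal_in A K ->
  abelian_set A -> A `<=` [set 1].

Definition just_infinite G := forall N, subgroup_of N G -> normal_in N G ->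
  N `<=` [set 1] \/ finite_index N G.

Lemma commuteJ x y g : commute x y -> commute (x ^ g) (y ^ g).
Proof. by move=> c; rewrite /commute -!conjMg c. Qed.

Lemma centralizer_subgroup K N : subgroup K -> subgroup (centralizer K N).
Proof.
move=> sK; apply/subgroupP; split=> [|x y [Kx cx] [Ky cy]].
  by split=> [|y _]; [apply: sg1 | apply/commute_sym/commute1].
split=> [|z Nz]; first exact: sgF.
apply/commute_sym/commuteM; first exact/commute_sym/cx.
exact/commuteV/commute_sym/cy.
Qed.

Lemma centralizer_normal K N : subgroup K -> normal_in N K ->
  normal_in (centralizer K N) K.
Proof.
move=> sK nN x k [Kx cx] Kk; split=> [|y Ny]; first exact: sgJ.
rewrite -[y](conjgKV k); apply/commuteJ/cx.
by apply: nN => //; apply: sgV.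
Qed.

(** The left-hand side consists of the elements of [C := centralizer K N] that
    commute with [C]: it is the centre of [C], an abelian normal subgroup of
    [K]. *)
Lemma centralizer_mulset_centralizer K N : subgroup K -> no_abelian_normal K ->
  subgroup_of N K -> normal_in N K ->
  centralizer K (N ** centralizer K N) `<=` [set 1].
Proof.
move=> sK abK [sN NK] nN; set C := centralizer K N.
have sC : subgroup C by apply: centralizer_subgroup.
have nC : normal_in C K by apply: centralizer_normal.
apply: abK.
- by split; [apply: centralizer_subgroup | move=> x []].
- by apply: centralizer_normal => //; apply: mulset_normal.
- move=> x y [Kx cx] [Ky cy]; apply: cx; apply: mulset_r; first exact: sg1.
  by split=> // z Nz; apply: cy; apply: mulset_l => //; apply: sg1.
Qed.

(** [D1 `&` centralizer K (D1 `&` D2)] meets [D2] in an abelian group, hence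
    trivially, and therefore commutes with [D2]. *)
Lemma centralizerI_trivial K D1 D2 : subgroup K -> no_abelian_normal K ->
  subgroup_of D1 K -> normal_in D1 K -> subgroup_of D2 K -> normal_in D2 K ->
  centralizer K D1 `<=` [set 1] -> centralizer K D2 `<=` [set 1] ->
  centralizer K (D1 `&` D2) `<=` [set 1].
Proof.
move=> sK abK [s1 D1K] n1 [s2 D2K] n2 c1 c2; set C := centralizer K (D1 `&` D2).
have sC : subgroup C by apply: centralizer_subgroup.
have nC : normal_in C K by apply: centralizer_normal => //; apply: normalI.
have tC : C `&` D1 `&` D2 `<=` [set 1].
  apply: abK.
  - by split=> [|x [[[]]]//]; apply: sgI => //; apply: sgI.
  - exact: normalI (normalI nC n1) n2.
  - by move=> x y [[[_ cx] _] _] [[_ D1y] D2y]; apply: cx.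
have trivC N D x y : subgroup N -> subgroup D -> normal_in N K -> normal_in D K ->
    N `<=` K -> D `<=` K -> N `&` D `<=` [set 1] -> N x -> D y -> commute x y.
  move=> sN sD nN nD NK DK tND Nx Dy; apply/commgP/eqP/tND; split.
    by apply: (sgM sN); [apply: (sgV sN) | apply: nN => //; apply: DK].
  rewrite commgEr; apply: (sgM sD) => //; apply: nD; [exact: sgV | exact: NK].
have CD1 : C `&` D1 `<=` [set 1].
  move=> x CDx; apply: c2; split=> [|y D2y]; first by case: CDx => -[].
  apply: (trivC (C `&` D1) D2) => //; first exact: sgI.
    exact: normalI.
  by move=> z [[]].
move=> x Cx; apply: c1; split=> [|y D1y]; first by case: Cx.
by apply: (trivC C D1) => // z [].
Qed.

Lemma centralizer_conj_trivial G K D t : subgroup G -> subgroup_of K G ->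
  normal_in K G -> G t -> subgroup_of D K -> normal_in D K ->
  centralizer K D `<=` [set 1] ->
  let E := [set x | K x /\ D (x ^ t)] in
  [/\ subgroup E, normal_in E K & centralizer K E `<=` [set 1]].
Proof.
move=> sG [sK KG] nK Gt [sD DK] nD cD E; split.
- apply/subgroupP; split=> [|x y [Kx Dx] [Ky Dy]].
    by split; [apply: sg1 | rewrite conj1g; apply: sg1].
  by split; [apply: sgF | rewrite conjMg conjVg; apply: sgF].
- move=> x k [Kx Dx] Kk; split; first exact: sgJ.
  by rewrite conjJg; apply: nD => //; apply: nK.
- move=> x [Kx cx]; apply/eqP; rewrite -(conjg_eq1 x t); apply/eqP/cD; split.
    exact: nK.
  move=> y Dy; rewrite -[y](conjgKV t); apply/commuteJ/cx; split.
    by apply: nK; [apply: DK | apply: sgV].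
  by rewrite conjgKV.
Qed.

(** By [centralizer_mulset_centralizer], [N ** centralizer K N] has trivial
    centralizer in [K], a property that survives intersecting it with its
    finitely many conjugates under [G].  Unless [K] is trivial, this
    intersection is thus a nontrivial normal subgroup of [G], and just
    infiniteness applies to it. *)
Lemma fi_mulset_centralizer G K N : subgroup G -> just_infinite G ->
  subgroup_of K G -> normal_in K G -> finite_index K G -> no_abelian_normal K ->
  subgroup_of N K -> normal_in N K ->
  finite_index (N ** centralizer K N) G.
Proof.
move=> sG jiG [sK KG] nK fK abK [sN NK] nN; set D := N ** _.
have sC : subgroup (centralizer K N) by apply: centralizer_subgroup.
have nC : normal_in (centralizer K N) K by apply: centralizer_normal.
have sD : subgroup D by apply: mulset_subgroup => //; apply: normalS nC.
have nD : normal_in D K by apply: mulset_normal.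
have DK : D `<=` K by apply: mulset_sub => // x [].
have cD : centralizer K D `<=` [set 1] by apply: centralizer_mulset_centralizer.
have [s sG' sP] := fi_reps sK fK.
pose I (r : seq gT) := [set x | K x /\ forall t, t \in r -> D (x ^ t)].
have IP (r : seq gT) : (forall t, t \in r -> G t) ->
    [/\ subgroup (I r), normal_in (I r) K & centralizer K (I r) `<=` [set 1]].
  elim: r => [_|t r IHr rG].
    have -> : I [::] = K by apply/seteqP; split=> x => [[]|].
    split=> //; first exact: normal_self.
    apply: abK; last by move=> x y [_ cx] [Ky _]; apply: cx.
      by split=> [|x []//]; apply: centralizer_subgroup.
    by apply: centralizer_normal => //; apply: normal_self.
  have [|sI nI cI] := IHr; first by move=> u ru; apply: rG; rewrite in_cons ru orbT.
  have Gt := rG t (mem_head t r).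
  have [sE nE cE] := centralizer_conj_trivial sG (conj sK KG) nK Gt (conj sD DK) nD cD.
  set E := [set x | _] in sE nE cE.
  have -> : I (t :: r) = E `&` I r.
    apply/seteqP; split=> x [].
      move=> Kx Dx; split; first by split=> //; apply: Dx; apply: mem_head.
      by split=> // u ru; apply: Dx; rewrite in_cons ru orbT.
    move=> [Kx Dt] [_ Dr]; split=> // u.
    by rewrite in_cons => /orP[/eqP->|/Dr].
  split; [exact: sgI | exact: normalI |].
  by apply: centralizerI_trivial => //; split=> // x [].
have [sI nI cI] := IP s sG'.
have ID g x : G g -> I s x -> D (x ^ g).
  move=> Gg [Kx Dx]; have [t st Kt] := sP g Gg.
  by rewrite -[g](mulVKg t) conjgM; apply: nD => //; apply: Dx.
have IG : normal_in (I s) G.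
  move=> x g Ix Gg; split=> [|t /sG' Gt]; first by apply: nK => //; case: Ix.
  by rewrite -conjgM; apply: ID => //; apply: sgM.
have IsG : subgroup_of (I s) G by split=> // x [/KG].
have ID1 : I s `<=` D by move=> x /(ID 1 x (sg1 sG)); rewrite conjg1.
have [I1|fI] := jiG (I s) IsG IG; last exact: fi_sup fI.
apply: fi_sup (fK) => // x Kx.
suff -> : x = 1 by apply: sg1.
apply: cI; split=> // y /I1 ->; exact: commute1.
Qed.

(** Up to finite index [K] may be assumed normal in [G].  Then [N] is the
    intersection of [N ** C], where [C] is its centralizer in [K], and of the
    centralizer of [C]: an element [c] of [C] that commutes with [C] is in the
    centre of [C], which is trivial. *)
Theorem separable_normal_subgroup G K N : subgroup G -> just_infinite G ->
  (forall L, subgroup_of L G -> finite_index L G -> no_abelian_normal L) ->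
  separable G [set 1] -> subgroup_of K G -> finite_index K G ->
  subgroup_of N K -> normal_in N K -> separable G N.
Proof.
move=> sG jiG abG sep1 [sK KG] fK [sN NK] nN.
have [K0 [[sK0 K0G] nK0 fK0 K0K]] := fi_core sK sG fK.
have NG : N `<=` G by move=> x /NK/KG.
pose M := N `&` K0.
have sM : subgroup M by apply: sgI.
have MK0 : M `<=` K0 by move=> x [].
have nM : normal_in M K0.
  by apply: normalI; [apply: normalS nN | apply: normal_self].
apply: (@separable_sup _ G M) => //; first by move=> x [].
  by apply: (fi_setI sN sK0); [apply: fi_refl | apply: fi_mono fK0].
have abK0 := abG K0 (conj sK0 K0G) fK0.
pose C := centralizer K0 M; have sC : subgroup C by apply: centralizer_subgroup.
have nC : normal_in C K0 by apply: centralizer_normal.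
have sMC : subgroup (M ** C) by apply: mulset_subgroup => //; apply: normalS nC.
have fMC : finite_index (M ** C) G by apply: fi_mulset_centralizer.
have CK0 : C `<=` K0 by move=> x [].
have MCG : subgroup_of (M ** C) G.
  by split=> //; apply: mulset_sub => // x []; [move=> /NG | move=> /K0G].
have -> : M = (M ** C) `&` centralizer G C.
  apply/seteqP; split=> x.
    move=> Mx; split; first by apply: mulset_l => //; apply: sg1.
    by split=> [|y [_ cy]]; [case: Mx => /NG | apply/commute_sym/cy].
  move=> [[m Mm [c Cc <-]] [_ cmc]].
  have cm y : C y -> commute y m by move=> [_]; apply.
  suff -> : c = 1 by rewrite mulg1.
  apply: (abK0 (C `&` centralizer K0 C)).
  - split; first by apply: sgI => //; apply: centralizer_subgroup.
    by move=> y [/CK0].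
  - by apply: normalI => //; apply: centralizer_normal.
  - by move=> y z [_ [_ cy]] [Cz _]; apply: cy.
  - split=> //; split=> [|y Cy]; first exact: CK0.
    apply: commute_sym; rewrite -[c](mulKg m); apply: commuteM.
      exact/commuteV/cm.
    exact/commute_sym/cmc.
apply: separableI; first exact: separable_finite_index.
by apply: separable_centralizer => // x /CK0/K0G.
Qed.

(** * Torsion groups *)

(** Add the generators of [H] to [N] one at a time: the torsion hypothesis
    makes each step of finite index. *)
Lemma fi_abelian_torsion H N : finitely_generated H -> subgroup_of N H ->
  normal_in N H -> (forall x y, H x -> H y -> N [~ x, y]) ->
  (forall x, H x -> exists2 n, (0 < n)%N & N (x ^+ n)) -> finite_index N H.
Proof.
move=> [A finA EH] [sN NH] nN abN torN.
have sH : subgroup H by rewrite EH; apply: gen_subgroup.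
have /finite_seqP[s As] := finA.
have : forall a, a \in s -> H a.
  by move=> a sa; rewrite EH; apply: gen_sub; rewrite As.
suff fNs (r : seq gT) : (forall a, a \in r -> H a) ->
    finite_index N (generated (N `|` [set` r])).
  move=> /fNs; apply: fi_mono; rewrite {1}EH.
  apply: gen_min; first exact: gen_subgroup.
  by move=> a; rewrite As => sa; apply: gen_sub; right.
elim: r => [_|a r IHr rH].
  apply: (fi_mono _ (fi_refl sN)); apply: gen_min => // x [//|].
  by rewrite /= in_nil.
set L := generated _ in IHr.
have sL : subgroup L by apply: gen_subgroup.
have NL : N `<=` L by move=> x Nx; apply: gen_sub; left.
have rH' b : b \in r -> H b by move=> rb; apply: rH; rewrite in_cons rb orbT.
have fNL := IHr rH'.
have LH : L `<=` H by apply: gen_min => // x [/NH//|/rH'].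
have nL : normal_in L H.
  move=> l h Ll Hh; rewrite -[l ^ h](mulVKg l); apply: (sgM sL) => //.
  by apply: NL; apply: (abN l h) => //; apply: LH.
have Ha : H a by apply: rH; rewrite mem_head.
have [n n0 Nan] := torN a Ha.
apply: (fi_trans sN sL fNL).
(* Only nonnegative powers of [a] are used: a submonoid [W] containing [N] is
   closed under inverses, because [H] is torsion modulo [N]. *)
pose W := [set x | H x /\ exists e : nat, L ((a ^+ e)^-1 * x)].
have LW : L `<=` W.
  by move=> x Lx; split; [apply: LH | exists 0%N; rewrite invg1 mul1g].
have WM x y : W x -> W y -> W (x * y).
  move=> [Hx [e Lx]] [Hy [f Ly]]; split; first exact: sgM.
  exists (e + f)%N; rewrite expgnDr.
  have -> : (a ^+ e * a ^+ f)^-1 * (x * y) =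
            ((a ^+ e)^-1 * x) ^ (a ^+ f) * ((a ^+ f)^-1 * y).
    by rewrite /conjg !gnorm.
  by apply: (sgM sL) => //; apply: nL => //; apply: sgX.
have WX x k : W x -> W (x ^+ k).
  move=> Wx; elim: k => [|k IHk]; first by exact: (LW _ (sg1 sL)).
  by rewrite expgS; apply: WM.
have sW : subgroup W.
  apply/subgroupP; split=> [|x y Wx Wy]; first by exact: (LW _ (sg1 sL)).
  apply: (WM) => //; have [Hy _] := Wy; have [[//|k] _ Nyk] := torN y Hy.
  have -> : y^-1 = y ^+ k / y ^+ k.+1 by rewrite expgS !gnorm.
  by apply: WM; [apply: WX | apply: LW; apply: NL; exact: sgV].
have rW : generated (N `|` [set` a :: r]) `<=` W.
  apply: gen_min => // x [/NL/LW//|].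
  rewrite /= in_cons => /orP[/eqP->|rx]; last by apply: LW; apply: gen_sub; right.
  by split=> //; exists 1%N; rewrite expg1 mulVg; apply: sg1.
apply: (@fi_of_reps _ _ _ [seq a ^+ e | e <- iota 0 n]) => // x /rW[Hx [e Le]].
exists (a ^+ (e %% n)); first by apply: map_f; rewrite mem_iota add0n /= ltn_pmod.
have -> : (a ^+ (e %% n))^-1 * x = a ^+ n ^+ (e %/ n) * ((a ^+ e)^-1 * x).
  by rewrite {3}(divn_eq e n) [(_ %/ _ * _ + _)%N]addnC expgnDr mulnC expgnA !gnorm.
by apply: (sgM sL) => //; apply: (sgX _ sL); exact: NL.
Qed.

End JustInfinite.

(** * Finite quotients *)

Section FiniteQuotients.
Import fingroup perm cyclic commutator pgroup sylow gseries abelian maximal Defs.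
Local Open Scope group_scope.
Local Open Scope classical_set_scope.
Context {gT : groupType}.
Implicit Types (G K M N V : set gT) (x y g : gT).

(** The permutation representation of [K] on the cosets of [V]. *)
Lemma finite_quotient K V : subgroup K -> subgroup_of V K -> finite_index V K ->
  exists (Q : finGroupType) (f : gT -> Q),
    hom_on K f /\ forall x, K x -> f x = 1 -> V x.
Proof.
move=> sK [sV VK] /finite_seqP[s Es].
pose act x (A : set gT) : set gT := [set z | A (x * z)].
have actP x A : K x -> A \in s -> act x A \in s.
  have sP B : B \in s <-> [set lcoset y V | y in K] B by rewrite Es.
  move=> Kx /sP[y Ky <-]; apply/sP; exists (x^-1 * y).
    by apply: sgM => //; apply: sgV.
  apply/seteqP; split=> z /lcoset_mem Vz; apply/lcoset_mem; move: Vz.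
    by rewrite invMg invgK mulgA.
  by rewrite invMg invgK mulgA.
pose T := seq_sub s.
pose f x (A : T) : T := insubd A (act x (val A)).
have fE x A : K x -> val (f x A) = act x (val A).
  by move=> Kx; rewrite insubdK //; apply: actP => //; apply: valP.
have fI x : K x -> injective (f x).
  move=> Kx A B /(congr1 val); rewrite !fE // => E; apply: val_inj.
  apply/seteqP; split=> z; rewrite -[z](mulKVg x).
    by move: E => /seteqP[E _]; apply: E.
  by move: E => /seteqP[_ E]; apply: E.
pose p x : {perm T} := if pselect (K x) is left Kx then perm (fI x Kx) else 1.
have pE x A : K x -> val (p x A) = act x (val A).
  by move=> Kx; rewrite /p; case: pselect => // Kx'; rewrite permE fE.
exists {perm T}, p; split=> [x y Kx Ky|x Kx p1].
  apply/perm.permP => A; rewrite permM; apply: val_inj.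
  rewrite !pE //; last exact: sgM.
  by apply/seteqP; split=> z; rewrite /act /= mulgA.
have Vs : V \in s.
  have /(_ V) : forall B, [set lcoset y V | y in K] B -> B \in s by rewrite Es.
  apply; exists 1; first exact: sg1.
  by apply/seteqP; split=> z; rewrite lcoset_mem invg1 mul1g.
have := pE x (SeqSub Vs) Kx; rewrite p1 perm1 /= => EV.
have : V 1 by apply: sg1.
by rewrite {1}EV /act /= mulg1.
Qed.

Definition imgset (Q : finGroupType) (f : gT -> Q) K : {set Q} :=
  [set q | `[< exists2 x, K x & f x = q >]].

Lemma imgsetP (Q : finGroupType) (f : gT -> Q) K q :
  reflect (exists2 x, K x & f x = q) (q \in imgset f K).
Proof. by rewrite inE; apply: asboolP. Qed.

Lemma imgset_group_set (Q : finGroupType) (f : gT -> Q) K M :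
  subgroup K -> hom_on K f -> subgroup_of M K -> group_set (imgset f M).
Proof.
move=> sK fM [sM MK]; apply/group_setP; split.
  by apply/imgsetP; exists 1; [apply: sg1 | apply: (hom_on1 sK fM)].
move=> _ _ /imgsetP[x Mx <-] /imgsetP[y My <-].
apply/imgsetP; exists (x * y); first exact: sgM.
by apply: fM; apply: MK.
Qed.

Lemma preim_finite_group K (Q : finGroupType) (f : gT -> Q) (Y : {group Q}) :
  subgroup K -> hom_on K f ->
  let M := [set x | K x /\ f x \in Y] in subgroup_of M K /\ finite_index M K.
Proof.
move=> sK fM M; have sM : subgroup M.
  apply/subgroupP; split=> [|x y [Kx Yx] [Ky Yy]].
    by split; [apply: sg1 | rewrite (hom_on1 sK fM) group1].
  split; first exact: sgF.
  by rewrite (hom_onF sK fM) // groupM // groupV.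
split; first by split=> // x [].
apply: (fi_fun (f := f)) => //.
move=> x y Kx Ky E; split; first by apply: sgM => //; apply: sgV.
by rewrite (hom_onVM sK fM) // E mulVg group1.
Qed.

(** [Y] is the preimage of a maximal subgroup of a finite quotient of [K]: in a
    finite [p]-group, maximal subgroups contain all [p]-th powers and
    commutators. *)
Lemma pgroup_fi_proper p K M : subgroup K -> is_pgroup p K -> subgroup_of M K ->
  finite_index M K -> M <> K ->
  exists Y, [/\ subgroup_of Y K, Y <> K, M `<=` Y, forall x, K x -> Y (x ^+ p) &
                forall x y, K x -> K y -> Y [~ x, y]].
Proof.
move=> sK [p_pr pK] [sM MK] fM MneK.
have [Q [f [fH kerf]]] := finite_quotient sK (conj sM MK) fM.
pose P : {group Q} := fingroup.Group (imgset_group_set sK fH (subgroup_of_refl sK)).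
pose L : {group Q} := fingroup.Group (imgset_group_set sK fH (conj sM MK)).
have Pf x : K x -> f x \in P by move=> Kx; apply/imgsetP; exists x.
have pP : p.-group P.
  apply/pgroupP => q q_pr /(Cauchy q_pr)[_ /imgsetP[x Kx <-] oq].
  have [n xn] := pK x Kx.
  have : (#[f x] %| p ^ n)%N.
    by rewrite order_dvdn -(hom_onX sK fH) // xn (hom_on1 sK fH).
  by rewrite oq Euclid_dvdX // => /andP[]; rewrite dvdn_prime2 // inE.
have LP : L \subset P.
  by apply/fintype.subsetP => _ /imgsetP[x /MK/Pf fx <-].
have [LeP|[Y maxY LY]] := maximal_exists LP.
  exfalso; apply: MneK; apply/seteqP; split=> // x Kx.
  have : f x \in L by rewrite LeP Pf.
  move=> /imgsetP[m Mm Em]; rewrite -[x](mulKVg m); apply: sgM => //.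
  apply: kerf; first by apply: sgM => //; apply: sgV => //; exact: (MK m).
  by rewrite (hom_onVM sK fH) ?Em ?mulVg //; exact: (MK m).
have PhiY := Phi_sub_max maxY; rewrite (Phi_joing pP) in PhiY.
have [sY _] := preim_finite_group Y sK fH.
exists [set x | K x /\ f x \in Y]; split=> //.
- move=> E; have /andP[_ /negP] := maxgroupp maxY; apply.
  apply/fintype.subsetP => _ /imgsetP[x Kx <-].
  by have [] : [set x | K x /\ f x \in Y] x by rewrite E.
- by move=> x Mx; split; [exact: (MK x) | apply: (fintype.subsetP LY); apply/imgsetP; exists x].
- move=> x Kx; split; first exact: sgX.
  rewrite (hom_onX sK fH) //; apply: (fintype.subsetP PhiY); apply: mem_gen.
  rewrite inE; apply/orP; right; rewrite -{1}(expn1 p); apply: Mho_p_elt; first exact: Pf.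
  by apply: (mem_p_elt pP); apply: Pf.
- move=> x y Kx Ky; split; first exact: sgR.
  rewrite /commg fH ?(hom_onV sK fH) ?(hom_onJ sK fH) //; last first.
  - exact: sgJ.
  - exact: sgV.
  apply: (fintype.subsetP PhiY); apply: mem_gen; rewrite inE; apply/orP; left.
  by rewrite -/(commg _ _); apply: mem_commg; apply: Pf.
Qed.

Lemma preim_maximal G (Q : finGroupType) (f : gT -> Q) (P Y : {group Q}) :
  subgroup G -> hom_on G f -> P = imgset f G :> {set Q} -> maximal Y P ->
  maximal_subgroup [set x | G x /\ f x \in Y] G.
Proof.
move=> sG fM EP maxY; have [sM _] := preim_finite_group Y sG fM.
have Pf x : G x -> f x \in P by move=> Gx; rewrite EP; apply/imgsetP; exists x.
split=> // [E|L sLG ML].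
  have /andP[_ /negP] := maxgroupp maxY; apply; rewrite EP.
  apply/fintype.subsetP => _ /imgsetP[x Gx <-].
  by have [] : [set x | G x /\ f x \in Y] x by rewrite E.
have [sL LG] := sLG.
pose L' : {group Q} := fingroup.Group (imgset_group_set sG fM sLG).
have YL : Y \subset L'.
  apply/fintype.subsetP => q Yq.
  have := fintype.subsetP (proper_sub (maxgroupp maxY)) q Yq.
  rewrite EP => /imgsetP[x Gx Ex]; apply/imgsetP; exists x => //.
  by apply: ML; rewrite /= Ex.
have LP : L' \subset P by apply/fintype.subsetP => _ /imgsetP[x /LG/Pf Gx <-].
have [PL|nPL] := boolP (P \subset L').
  right; apply/seteqP; split=> // x Gx.
  have /imgsetP[l Ll El] := fintype.subsetP PL _ (Pf x Gx).
  rewrite -[x](mulVKg l); apply: sgM => //; apply: ML.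
  have Gl := LG l Ll; split; first by apply: sgM => //; apply: sgV.
  by rewrite (hom_onVM sG fM) // El mulVg group1.
left; have /maxgroupP[_ maxE] := maxY.
have EL : L' = Y :> {set Q} by apply: maxE => //; rewrite properE LP.
apply/seteqP; split=> // x Lx; split; first exact: LG.
by rewrite -EL; apply/imgsetP; exists x.
Qed.

(** By the Frattini argument ['N_P(S)] supplements ['Phi(P)] in [P], and
    ['Phi(P)] consists of non-generators, so that [S] is normal in [P]. *)
Lemma Phi_Sylow_normal (Q : finGroupType) (P S : {group Q}) p :
  p.-Sylow('Phi(P)) S -> S <| 'Phi(P).
Proof.
move=> sylS; have nPhi := Phi_normal P.
have E := Frattini_arg nPhi sylS.
have NE : <<'N_P(S)>> = P :> {set Q}.
  apply: Phi_nongen; apply/eqP; rewrite finset.eqEsubset join_subG Phi_sub finset.subsetIl /=.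
  by rewrite -{1}E mulG_subG joing_subl joing_subr.
have SPhi := pHall_sub sylS; rewrite /normal SPhi /=.
apply: fintype.subset_trans (Phi_sub P) _; apply/finset.setIidPl; rewrite -{2}NE.
by rewrite genGid.
Qed.

(** The images of the Frattini subgroup in finite quotients lie in Frattini
    subgroups, in which the [p]-elements form a subgroup, the normal Sylow
    [p]-subgroup; residual finiteness carries this over to [G]. *)
Lemma frattini_p_elements G (p : nat) : subgroup G -> separable G [set 1] ->
  (forall x, G x -> exists2 n, (0 < n)%N & x ^+ n = 1) ->
  subgroup (finite_index_frattini G) ->
  subgroup [set x | finite_index_frattini G x /\ exists2 n, p.-nat n & x ^+ n = 1].
Proof.
move=> sG sep1 torG sN; set N := finite_index_frattini G in sN *.
apply/subgroupP; split=> [|x y [Nx [n pin xn]] [Ny [m pim ym]]].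
  by split; [apply: sg1 | exists 1%N].
have Nz : N (x * y^-1) by apply: sgF.
split=> //; have [k k0 zk] := torG _ Nz.1.
exists (k`_p)%N; first exact: part_pnat.
set z := x * y^-1 in Nz zk *; apply: contrapT => w1.
have Gw : G (z ^+ k`_p) by apply: sgX => //; case: Nz.
have [V [sV fV _ nVw]] := sep1 _ Gw w1.
have [Q [f [fM kerf]]] := finite_quotient sG sV fV.
apply: nVw; apply: kerf => //.
pose P : {group Q} := fingroup.Group (imgset_group_set sG fM (subgroup_of_refl sG)).
have fPhi t : N t -> f t \in 'Phi(P).
  move=> [Gt Nt]; have Pt : f t \in P by apply/imgsetP; exists t.
  apply/bigcapP => Y /orP[/eqP->//|maxY].
  have [_ fY] := preim_finite_group Y sG fM.
  have maxM := preim_maximal (P := P) sG fM erefl maxY.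
  by have [] := Nt _ maxM fY.
have [S sylS] := Sylow_exists p 'Phi(P); have nS := Phi_Sylow_normal sylS.
have fS t l : N t -> p.-nat l -> t ^+ l = 1 -> f t \in S.
  move=> Nt pil tl; rewrite (mem_normal_Hall sylS nS) ?fPhi //.
  apply: (@pnat_dvd _ l) => //; rewrite order_dvdn -(hom_onX sG fM) ?tl; last by case: Nt.
  by rewrite (hom_on1 sG fM).
have Sz : f z \in S.
  by rewrite (hom_onF sG fM) ?groupM ?groupV ?(fS x n) ?(fS y m) //; [case: Nx | case: Ny].
have pz : p.-elt (f z) by apply: mem_p_elt Sz; apply: pHall_pgroup sylS.
rewrite (hom_onX sG fM); last by case: Nz.
apply/eqP; rewrite -order_eq1; apply/eqP.
apply: (@pnat_1 p); first by have := p_eltX k`_p pz.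
apply: (@pnat_dvd _ k`_p^'); last exact: part_pnat.
rewrite order_dvdn -expgnA partnC // -(hom_onX sG fM) ?zk; last by case: Nz.
by rewrite (hom_on1 sG fM).
Qed.

End FiniteQuotients.

(** * Maximal subgroups *)

Lemma expg_coprime1 (gT : groupType) (x : gT) n m : (0 < n)%N -> coprime n m ->
  x ^+ n = 1 -> x ^+ m = 1 -> x = 1.
Proof.
move=> n0 co xn xm; case: (egcdnP m n0) => a b E _.
have : x ^+ (a * n)%N = x ^+ (b * m + 1)%N by rewrite E (eqP co).
by rewrite expgnDr expg1 [(a * n)%N]mulnC [(b * m)%N]mulnC !expgnA xn xm !expg1n mul1g.
Qed.

Section Maximal.
Context {gT : groupType}.
Implicit Types (E G H K L M N V W : set gT) (x y g : gT).

(** Zorn's lemma: as [H] is finitely generated, the union of a chain of proper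
    subgroups is proper. *)
Lemma maximal_subgroup_exists H V : finitely_generated H -> subgroup_of V H ->
  V <> H -> exists2 M, maximal_subgroup M H & V `<=` M.
Proof.
move=> [A finA EH] [sV VH] VneH.
have sH : subgroup H by rewrite EH; apply: gen_subgroup.
(* [set0] is admitted as the union of the empty chain. *)
pose P B := B = set0 \/ [/\ subgroup_of B H, B <> H & V `<=` B].
have [F FP totF|M [[M0|[sMH MneH VM]] maxM]] := @Zorn_bigcup _ P; last 2 first.
- exfalso; apply: (maxM V); last by right; split.
  rewrite M0; split=> [x []|V0]; exact: (V0 1 (sg1 sV)).
- exists M => //; split=> // L sLH ML; have [->|LneM] := pselect (L = M); first by left.
  right; apply: contrapT => LneH; apply: (maxM L).
    by split=> // LM; apply: LneM; apply/seteqP.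
  by right; split=> // x /VM/ML.
have [[B FB [b Bb]]|nB] := pselect (exists2 B, F B & B !=set0); last first.
  left; apply/seteqP; split=> // x [B FB Bx]; apply: nB.
  by exists B => //; exists x.
have F' C : F C -> C !=set0 -> [/\ subgroup_of C H, C <> H & V `<=` C].
  by move=> /FP[->|//] [].
have [[sB BH] BneH VB] := F' B FB (ex_intro _ b Bb).
right; split; last first.
- by move=> x Vx; exists B => //; apply: VB.
- move=> UH.
  have /finite_seqP[s As] := finA.
  have [C [FC BC AC]] : exists C, [/\ F C, B `<=` C & forall a, a \in s -> C a].
    have : forall a, a \in s -> (\bigcup_(X in F) X) a.
      by move=> a sa; rewrite UH EH; apply: gen_sub; rewrite As.
    elim: (s) => [_|a r IHr rU]; first by exists B; split=> // a; rewrite in_nil.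
    have [|C [FC BC rC]] := IHr; first by move=> c rc; apply: rU; rewrite in_cons rc orbT.
    have [D FD Da] := rU a (mem_head a r).
    have [CD|DC] := totF C D FC FD.
      exists D; split=> // [x /BC/CD//|c]; rewrite in_cons => /orP[/eqP->//|/rC/CD//].
    by exists C; split=> // c; rewrite in_cons => /orP[/eqP->|/rC//]; apply: DC.
  have [|[sC CH] CneH _] := F' C FC; first by exists b; apply: BC.
  apply: CneH; apply/seteqP; split=> //; rewrite EH; apply: gen_min => // a.
  by rewrite As => /AC.
split; last by move=> x [C FC Cx]; have [|[_ CH] _ _] := F' C FC; [exists x | apply: CH].
apply/subgroupP; split; first by exists B => //; apply: sg1.
move=> x y [C FC Cx] [D FD Dy].
have [[sC _] _ _] := F' C FC (ex_intro _ x Cx).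
have [[sD _] _ _] := F' D FD (ex_intro _ y Dy).
have [CD|DC] := totF C D FC FD; [exists D|exists C] => //; apply: sgF => //.
- exact: CD.
- exact: DC.
Qed.

Lemma maximal_conj G M g : subgroup G -> G g -> maximal_subgroup M G ->
  maximal_subgroup [set x | G x /\ M (x ^ g)] G.
Proof.
have conjS L h : subgroup G -> subgroup L -> G h -> subgroup_of [set x | G x /\ L (x ^ h)] G.
  move=> sG sL Gh; split=> [|x []//]; apply/subgroupP; split.
    by split; [apply: sg1 | rewrite conj1g; apply: sg1].
  by move=> x y [Gx Lx] [Gy Ly]; split; [apply: sgF | rewrite conjMg conjVg; apply: sgF].
move=> sG Gg [[sM MG] MneG maxM]; have sM' := conjS M g sG sM Gg; split=> //.
  move=> E; apply: MneG; apply/seteqP; split=> // x Gx.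
  have : G (x ^ g^-1) by apply: sgJ => //; apply: sgV.
  by rewrite -E /= => -[_]; rewrite conjgKV.
move=> L [sL LG] ML; have Gg' := sgV sG Gg.
have [|EM|EG] := maxM _ (conjS L g^-1 sG sL Gg').
- move=> x Mx; split; first exact: MG.
  apply: ML; split; last by rewrite conjgKV.
  by apply: sgJ => //; apply: MG.
- left; apply/seteqP; split=> // x Lx; split; first exact: LG.
  by rewrite -EM; split; [apply: sgJ => //; apply: LG | rewrite conjgK].
- right; apply/seteqP; split=> // x Gx; have : G (x ^ g) by apply: sgJ.
  by rewrite -EG /= conjgK => -[].
Qed.

Lemma frattini_subgroup G : subgroup G -> subgroup_of (finite_index_frattini G) G.
Proof.
move=> sG; split=> [|x []//]; apply/subgroupP; split.
  by split=> [|M [[sM _] _ _] _]; apply: sg1.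
move=> x y [Gx fx] [Gy fy]; split=> [|M maxM fM]; first exact: sgF.
by have [[sM _] _ _] := maxM; apply: sgF => //; [apply: fx | apply: fy].
Qed.

Lemma frattini_normal G : subgroup G -> normal_in (finite_index_frattini G) G.
Proof.
move=> sG x g [Gx fx] Gg; split=> [|M maxM fM]; first exact: sgJ.
have [[sM MG] _ _] := maxM; have maxMg := maximal_conj sG Gg maxM.
have [] // := fx _ maxMg; have [sMg fMg] := fi_conj sM sG Gg fM.
by apply: fi_setI => //; apply: fi_refl.
Qed.

(** * Groups which are virtually p-groups *)

(** For a finite [p]-group this is the Frattini subgroup. *)
Definition power_commutators p K : set gT :=
  generated ([set x ^+ p | x in K] `|` [set [~ x, y] | x in K & y in K]).

Lemma power_commutators_sub p K : subgroup K -> power_commutators p K `<=` K.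
Proof.
move=> sK; apply: gen_min => // _ [[x Kx <-]|[x Kx [y Ky <-]]].
  exact: sgX.
exact: sgR.
Qed.

Lemma power_commutators_normal p K H : normal_in K H ->
  normal_in (power_commutators p K) H.
Proof.
move=> nK; apply: gen_normal => _ h [[x Kx <-]|[x Kx [y Ky <-]]] Hh.
  by left; exists (x ^ h); [apply: nK | rewrite conjXg].
right; exists (x ^ h); first exact: nK.
by exists (y ^ h); [apply: nK | rewrite conjRg].
Qed.

Lemma fi_power_commutators p K : subgroup K -> finitely_generated K -> prime p ->
  finite_index (power_commutators p K) K.
Proof.
move=> sK fgK p_pr; apply: fi_abelian_torsion => //.
- by split; [apply: gen_subgroup | apply: power_commutators_sub].
- by apply: power_commutators_normal; apply: normal_self.
- move=> x y Kx Ky.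
  by apply: (@gen_sub _ (_ `|` _)); right; exists x => //; exists y.
- move=> x Kx; exists p; first exact: prime_gt0.
  by apply: (@gen_sub _ (_ `|` _)); left; exists x.
Qed.

(** If a finite-index maximal subgroup [M] of [H] does not contain the normal
    subgroup [power_commutators p K], their product is [H].  Then
    [K `&` M] supplements [power_commutators p K] in [K], which is only
    possible for [K `&` M = K]. *)
Lemma power_commutators_sub_maximal p K H M : subgroup H -> subgroup_of K H ->
  normal_in K H -> is_pgroup p K -> maximal_subgroup M H -> finite_index M H ->
  power_commutators p K `<=` M.
Proof.
move=> sH [sK KH] nK pK [[sM MH] MneH maxM] fM; set F := power_commutators p K.
have sF : subgroup F by apply: gen_subgroup.
have FK : F `<=` K by apply: power_commutators_sub.
have nF : normal_in F H by apply: power_commutators_normal.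
have sMF : subgroup (M ** F) by apply: mulset_subgroup => //; apply: normalS nF.
have [||EM|EH] := maxM (M ** F).
- by split=> //; apply: mulset_sub => // x /FK/KH.
- by apply: mulset_l; apply: sg1.
- by rewrite -EM; apply: mulset_r; apply: sg1.
have [EK|KMneK] := pselect (K `&` M = K).
  by move=> x /FK; rewrite -EK => -[].
have sKM := sgI sK sM.
have [||Y [[sY YK] YneK KMY Yp Yc]] := pgroup_fi_proper sK pK _ _ KMneK.
- by split=> // x [].
- apply: fi_setI => //; first exact: fi_refl.
  exact: fi_mono fM.
exfalso; apply: YneK; apply/seteqP; split=> // k Kk.
have FY : F `<=` Y.
  apply: gen_min => // _ [[x Kx <-]|[x Kx [y Ky <-]]]; first exact: Yp.
  exact: Yc.
have : (M ** F) k by rewrite EH; apply: KH.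
move=> [m Mm [f Ff mfk]]; rewrite -mfk; apply: sgM => //; last exact: FY.
apply: KMY; split=> //; apply: (sgMr sK (FK f Ff)).
by rewrite mfk.
Qed.

(** Take [M0] generated by representatives of the cosets of [E] that meet [M].
    As [M0] is a separable proper subgroup of [H], it is contained in a maximal
    subgroup of finite index, which also contains [E], hence [M]. *)
Lemma maximal_fi_of_separable H E : subgroup H -> finitely_generated H ->
  subgroup E -> finite_index E H ->
  (forall M, maximal_subgroup M H -> finite_index M H -> E `<=` M) ->
  (forall L, subgroup_of L H -> finitely_generated L -> separable H L) ->
  forall M, maximal_subgroup M H -> finite_index M H.
Proof.
move=> sH fgH sE fE EM sepH M [[sM MH] MneH maxM].
have [s sM' sP] := fi_reps sE (fi_mono MH fE).
pose M0 := generated [set` s]; have sM0 : subgroup M0 by apply: gen_subgroup.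
have M0M : M0 `<=` M by apply: gen_min.
have M0H : M0 `<=` H by move=> x /M0M/MH.
have [h [Hh nMh]] : exists h, H h /\ ~ M h.
  apply: contra_notP MneH => nE; apply/seteqP; split=> // x Hx.
  by apply: contra_notP nE => nMx; exists x.
have fgM0 : finitely_generated M0 by exists [set` s] => //; apply: finite_seq.
have [|V [[sV VH] fV M0V nVh]] := sepH M0 (conj sM0 M0H) fgM0 h Hh.
  by move=> /M0M.
have VneH : V <> H by move=> E1; apply: nVh; rewrite E1.
have [M' maxM' VM'] := maximal_subgroup_exists fgH (conj sV VH) VneH.
have [[sM1 M1H] M1neH _] := maxM'.
have fM' : finite_index M' H by apply: fi_sup fV.
have MM' : M `<=` M'.
  move=> x Mx; have [t st Et] := sP x Mx.
  rewrite -[x](mulVKg t); apply: sgM => //; first by apply: VM'; apply: M0V; exact: gen_sub.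
  by apply: EM Et.
by have [<-|] := maxM M' (conj sM1 M1H) MM'.
Qed.

(** If [W] were not separable, the intersection of the finite-index subgroups
    containing it would have finite index, hence be finitely generated; a
    maximal subgroup of this intersection containing [W] is of finite index,
    which is absurd. *)
Lemma weakly_maximal_separable H W : subgroup H -> finitely_generated H ->
  (forall L, subgroup_of L H -> finitely_generated L ->
     forall M, maximal_subgroup M L -> finite_index M L) ->
  weakly_maximal_subgroup W H -> separable H W.
Proof.
move=> sH fgH maxfi [[sW WH] nfW maxW] g Hg nWg; apply: contrapT => nV.
pose C := [set x | H x /\ forall V, subgroup_of V H -> finite_index V H ->
  W `<=` V -> V x].
have sC : subgroup C.
  apply/subgroupP; split=> [|x y [Hx Cx] [Hy Cy]].
    by split=> [|V [sV _] _ _]; apply: sg1.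
  split=> [|V sVH fV WV]; first exact: sgF.
  by have [sV _] := sVH; apply: sgF => //; [apply: Cx | apply: Cy].
have CH : C `<=` H by move=> x [].
have WC : W `<=` C by move=> x Wx; split=> [|V _ _ WV]; [apply: WH | apply: WV].
have Cg : C g.
  split=> // V sV fV WV; apply: contra_notP nV => nVg.
  by exists V.
have CneW : W <> C by move=> E; apply: nWg; rewrite E.
have fC : finite_index C H.
  by apply: contrapT => nfC; apply: CneW; rewrite (maxW C).
have fgC : finitely_generated C by apply: fg_finite_index fC.
have [M maxM WM] := maximal_subgroup_exists fgC (conj sW WC) CneW.
have fM := maxfi C (conj sC CH) fgC M maxM.
have [[sM MC] MneC _] := maxM; apply: MneC; apply/seteqP; split=> // x [_ Cx].
apply: Cx => //; first by split=> // y /MC/CH.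
exact: fi_trans fC.
Qed.

(** A nontrivial Frattini subgroup has a nontrivial subgroup of [p]-elements
    for some prime [p], which has finite index.  For two different primes
    these subgroups intersect trivially, so there is only one such [p]. *)
Lemma frattini_pgroup G : subgroup G -> separable G [set 1] -> just_infinite G ->
  infinite_set G -> (forall x, G x -> exists2 n, (0 < n)%N & x ^+ n = 1) ->
  finite_index_frattini G <> [set 1] ->
  finite_index (finite_index_frattini G) G /\
  exists p, is_pgroup p (finite_index_frattini G).
Proof.
move=> sG sep1 jiG infG torG; set N := finite_index_frattini G => ntN.
have [sN NG] := frattini_subgroup sG; have nN := frattini_normal sG.
rewrite -/N in sN NG nN.
pose Np (p : nat) := [set x | N x /\ exists2 n, p.-nat n & x ^+ n = 1].
have sNp p : subgroup (Np p) by exact: (frattini_p_elements p sG sep1 torG sN).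
have NpG p : subgroup_of (Np p) G by split=> // x [/NG].
have nNp p : normal_in (Np p) G.
  move=> x g [Nx [n pn xn]] Gg; split; first exact: nN.
  by exists n => //; rewrite -conjXg xn conj1g.
have order_dec x : G x -> x <> 1 -> exists p y, [/\ prime p, y <> 1, y ^+ p = 1 &
   exists k, y = x ^+ k].
  move=> Gx x1; have [n n0 xn] := torG x Gx.
  have ex : exists n, (0 < n)%N && `[< x ^+ n = 1 >].
    by exists n; rewrite n0; apply/asboolP.
  case: (ex_minnP ex) => m /andP[m0 /asboolP xm] minm.
  have m1 : (1 < m)%N.
    by rewrite ltn_neqAle m0 andbT eq_sym; apply/eqP => E; apply: x1; rewrite -xm E.
  exists (pdiv m), (x ^+ (m %/ pdiv m)); split.
  - exact: pdiv_prime.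
  - move=> E; have /minm : (0 < m %/ pdiv m)%N && `[< x ^+ (m %/ pdiv m) = 1 >].
      by rewrite divn_gt0 ?pdiv_gt0 // dvdn_leq ?pdiv_dvd //; apply/asboolP.
    by rewrite leqNgt ltn_Pdiv // prime_gt1 // pdiv_prime.
  - by rewrite -expgnA divnK // pdiv_dvd.
  - by exists (m %/ pdiv m).
have Np_prime x p y : N x -> prime p -> y ^+ p = 1 -> (exists k, y = x ^+ k) -> Np p y.
  move=> Nx pp yp [k E]; split; first by rewrite E; apply: sgX.
  by exists p => //; apply: pnat_id.
have Npq p q : prime p -> prime q -> p <> q -> Np p `&` Np q `<=` [set 1].
  move=> pp qq pq x [[_ [n pn xn]] [_ [m qm xm]]] /=.
  have n0 : (0 < n)%N by case/andP: pn.
  have co : coprime n m.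
    apply: pnat_coprime pn _; apply: sub_in_pnat qm => r _ /[!inE] /eqP->.
    by apply/eqP => E; apply: pq.
  exact: expg_coprime1 xn xm.
have [x [Nx x1]] : exists x, N x /\ x <> 1.
  apply: contra_notP ntN => nE; apply/seteqP; split=> [x Nx|_ ->]; last exact: sg1.
  by apply: contra_notP nE => x1; exists x.
have [p [y [pp y1 yp yk]]] := order_dec x (NG x Nx) x1.
have Npy : Np p y by apply: Np_prime yk.
have fNp : finite_index (Np p) G.
  by have [/(_ y Npy)|//] := jiG (Np p) (NpG p) (nNp p).
split; first by apply: fi_sup fNp => // z [].
have trivq q : prime q -> p <> q -> Np q `<=` [set 1].
  move=> qq pq; have [//|fNq] := jiG (Np q) (NpG q) (nNp q).
  exfalso; apply: infG; apply/(fi_finite sG).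
  have sI := sgI (sNp p) (sNp q).
  apply: (fi_sup sI sg_set1 (Npq p q pp qq pq)).
  exact: fi_setI.
exists p; split=> // z Nz; have [m m0 zm] := torG z (NG z Nz).
exists (logn p m); rewrite -p_part; apply: contrapT => z1.
have Gzm : G (z ^+ m`_p) by apply: sgX => //; apply: NG.
have [q [t [qq t1 tq [k tk]]]] := order_dec _ Gzm z1.
have [Epq|pq] := pselect (p = q); last first.
  apply: t1; apply: (trivq q qq pq); apply: (Np_prime z) => //.
  by exists (m`_p * k)%N; rewrite expgnA.
subst q.
have co : coprime p m`_p^'.
  by apply: (pnat_coprime (pi := p)); [apply: pnat_id | apply: part_pnat].
have tm : t ^+ m`_p^' = 1.
  by rewrite tk -!expgnA mulnA mulnAC partnC // expgnA zm expg1n.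
exact/t1/(expg_coprime1 (prime_gt0 pp) co).
Qed.

End Maximal.

Lemma gen_commutators (gT : groupType) (K N A : set gT) : subgroup K ->
  subgroup N -> normal_in N K -> A `<=` K ->
  (forall a b, A a -> A b -> N [~ a, b]) ->
  forall x y, generated A x -> generated A y -> N [~ x, y].
Proof.
move=> sK sN nN AK NA x y Ax.
have commN z t : N [~ z, t] -> N [~ t, z] by move=> /(sgV sN); rewrite invgR.
have Kx : K x by apply: (gen_min sK AK).
have sA : subgroup [set z | K z /\ forall c, A c -> N [~ z, c]].
  exact: relative_centralizer_subgroup.
have NxA : forall c, A c -> N [~ x, c].
  have [|_] := gen_min sA _ Ax; last exact.
  by move=> a Aa; split=> [|c]; [apply: AK | apply: NA].
have sx : subgroup [set z | K z /\ forall c, [set x] c -> N [~ z, c]].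
  by apply: relative_centralizer_subgroup => // _ ->.
move=> Ay; apply: (commN); have [|_] := gen_min sx _ Ay; last exact.
by move=> a Aa; split=> [|_ ->]; [apply: AK | apply: commN; apply: NxA].
Qed.

(** * Rigid stabilizers *)

Section Tree.
Context {d : nat}.
Implicit Types (G H K A N : set (tree_aut d)) (g x y a : tree_aut d).
Implicit Types (u v w : seq 'I_d).

Lemma aut_size g w : size (g w) = size w.
Proof. exact: tree_aut_size (tree_autP g). Qed.

Lemma aut_inj g : injective g.
Proof. by have [/bij_inj] := tree_autP g. Qed.

Lemma autKV g w : g^-1 (g w) = w.
Proof. by rewrite -tree_autME mulVg. Qed.

Lemma autVK g w : g (g^-1 w) = w.
Proof. by rewrite -tree_autME mulgV. Qed.

Lemma aut_moves g : g <> 1 -> exists w, g w <> w.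
Proof.
move=> g1; apply: contra_notP g1 => nE; apply: tree_aut_ext => w.
by apply: contra_notP nE => gw; exists w.
Qed.

Lemma prefix_aut g v w : prefix (g v) (g w) = prefix v w.
Proof.
have pre (h : tree_aut d) s t : prefix s t -> prefix (h s) (h t).
  by move=> /prefixP[r ->]; rewrite sectionE prefix_prefix.
by apply/idP/idP => [/(pre g^-1)|/pre//]; rewrite !autKV.
Qed.

Lemma prefix_eq_size u v : size u = size v -> prefix u v -> u = v.
Proof. by move=> suv; rewrite prefixE suv take_size => /eqP. Qed.

Lemma finite_level n : finite_set (level n : set (seq 'I_d)).
Proof.
apply: sub_finite_set (finite_image val (@finite_finset (n.-tuple 'I_d) setT)).
by move=> v /eqP sv; exists (Tuple sv).
Qed.

Lemma rist_subgroup G v : subgroup G -> subgroup (rist G v).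
Proof.
move=> sG; apply/subgroupP; split; first by split; [apply: sg1|].
move=> x y [Gx fx] [Gy fy]; split=> [|w vw]; first exact: sgF.
by rewrite tree_autME -{1}(fy w vw) autKV fx.
Qed.

Lemma rist_root G v x : rist G v x -> x v = v.
Proof.
move=> [_ fx]; have [vxv|vxv] := boolP (prefix v (x v)).
  by rewrite -(prefix_eq_size _ vxv) // aut_size.
by apply: (@aut_inj x); rewrite fx.
Qed.

Lemma rist_prefix G v x w : rist G v x -> prefix v (x w) = prefix v w.
Proof. by move=> /rist_root E; rewrite -{1}E prefix_aut. Qed.

Lemma ristJ G v x g : subgroup G -> G g -> rist G v x -> rist G (g^-1 v) (x ^ g).
Proof.
move=> sG Gg [Gx fx]; split; first exact: sgJ.
move=> w; rewrite -(prefix_aut g) autVK => /fx gw.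
by rewrite /conjg !tree_autME gw autKV.
Qed.

Lemma rist_disjoint_fix G u v x w : rist G u x -> size u = size v -> u <> v ->
  prefix v w -> x w = w.
Proof.
move=> [_ fx] suv nuv vw; apply: fx; apply/negP => uw; apply: nuv.
by move: vw uw; rewrite !prefixE suv => /eqP-> /eqP.
Qed.

Lemma rist_commute G u v x y : rist G u x -> rist G v y -> size u = size v ->
  u <> v -> commute x y.
Proof.
move=> rx ry suv nuv; apply: tree_aut_ext => w; rewrite !tree_autME.
have nvu : v <> u by move/esym.
have [uw|nuw] := boolP (prefix u w).
  by rewrite !(rist_disjoint_fix ry _ nvu) // (rist_prefix _ rx).
have [_ fx] := rx; rewrite (fx w nuw) fx //; apply: contra nuw => uyw.
rewrite -(prefix_aut y); suff -> : y u = u by [].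
exact: (rist_disjoint_fix ry (esym suv) nvu (prefix_refl u)).
Qed.

(** If [a] moves [v], the commutator of [a] with an element [x] of the rigid
    stabilizer of [v] is the product of [x] with an element which is rigid
    elsewhere. *)
Lemma rist_commutator G v a x : subgroup G -> G a -> rist G v x ->
  exists2 b, rist G (a^-1 v) b & [~ a, x] = b * x.
Proof.
move=> sG Ga rx; exists (x^-1 ^ a); last exact: commgEr.
by apply: ristJ => //; apply: (sgV (rist_subgroup v sG)).
Qed.

Lemma aut_moveV a v : a v <> v -> a^-1 v <> v.
Proof. by move=> av av'; apply: av; rewrite -{1}av' autVK. Qed.

Lemma vertex_stab_fi G w : subgroup G -> let S := [set g | G g /\ g w = w] in
  subgroup S /\ finite_index S G.
Proof.
move=> sG S; have sS : subgroup S.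
  apply/subgroupP; split=> [|x y [Gx xw] [Gy yw]]; first by split=> //; apply: sg1.
  by split; [apply: sgF | rewrite tree_autME -{1}yw autKV].
split=> //; apply: (fi_fun (f := fun g : tree_aut d => g w)) => //.
  by apply: sub_finite_set (finite_level (size w)) => _ [g _ <-]; apply: aut_size.
move=> x y Gx Gy E; split; first by apply: sgM => //; apply: sgV.
by rewrite tree_autME -E autKV.
Qed.

Lemma residually_finite G : subgroup G -> separable G [set 1].
Proof.
move=> sG g Gg /= /aut_moves[w gw]; have [sS fS] := vertex_stab_fi w sG.
exists [set g | G g /\ g w = w]; split=> //; first by split=> // x [].
  by move=> _ ->; split=> //; apply: sg1.
by case.
Qed.

(** * Sections at the first level *)

Lemma section_hom G v : level 1 v -> hom_on (stab G (level 1)) (section v).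
Proof.
move=> v1 x y _ [_ /(_ v v1) yv]; apply/esym/section_uniq => w.
by rewrite !tree_autME sectionE yv sectionE.
Qed.

Lemma sections_trivial G x : stab G (level 1) x ->
  (forall v, level 1 v -> section v x = 1) -> x = 1.
Proof.
move=> [_ sx] x1; apply: tree_aut_ext => -[|i w].
  by apply: size0nil; rewrite aut_size.
by rewrite -cat1s sectionE x1 // sx.
Qed.

Lemma stab_level1_fi G : subgroup G ->
  subgroup (stab G (level 1)) /\ finite_index (stab G (level 1)) G.
Proof.
move=> sG; have /finite_seqP[s Es] := finite_level 1.
have [t|] := @fi_bigI _ _ s (fun w => [set g | G g /\ g w = w]) G sG.
  by move=> _; apply: vertex_stab_fi.
suff -> : stab G (level 1) =
    [set x | G x /\ forall w, w \in s -> [set g | G g /\ g w = w] x] by [].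
apply/seteqP; split=> x [Gx sx]; split=> // w.
  by move=> sw; split=> //; apply: sx; rewrite Es.
by rewrite Es => /sx[].
Qed.

End Tree.

(** * Branch groups *)

Section Branch.
Context {d : nat} (G : set (tree_aut d)).
Hypotheses (sG : subgroup G) (brG : branch G).
Implicit Types (H K A N : set (tree_aut d)) (g x y a : tree_aut d).
Implicit Types (u v w : seq 'I_d).

Lemma branch_infinite : infinite_set G.
Proof.
have [_ infR _] := brG; have inf := infR [::].
by apply: sub_infinite_set inf => x [].
Qed.

Lemma fi_rist_nontrivial K v : subgroup_of K G -> finite_index K G ->
  exists2 x, rist K v x & x <> 1.
Proof.
move=> [sK KG] fK; apply: contrapT => nE.
have [_ /(_ v) infR _] := brG; apply: infR.
have sR := rist_subgroup v sG.
apply/(fi_finite sR); apply: (@fi_sup _ (K `&` rist G v)).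
- exact: sgI.
- exact: sg_set1.
- move=> x [Kx [_ fx]]; apply: contra_notP nE => x1; exists x => //.
- apply: fi_setI => //; last exact: fi_refl.
  by apply: fi_mono fK => x [].
Qed.

(** Suppose that [a] in [A] moves [v].  Every element [z] of the rigid
    stabilizer of [v] in [K] acts on the subtree at [v] as the element [[~ a, z]]
    of [A], so that the rigid stabilizer of [v] is abelian.  But an element [x]
    of it that moves [w] does not commute with the nontrivial elements of the
    rigid stabilizer of [w]. *)
Lemma fi_no_abelian_normal K : subgroup_of K G -> finite_index K G ->
  no_abelian_normal K.
Proof.
move=> sKG fK A [sA AK] nA abA a Aa; apply: contrapT => /aut_moves[v av].
have [sK KG] := sKG; have Ka := AK a Aa.
have [x rx /aut_moves[w xw]] := fi_rist_nontrivial v sKG fK.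
have vw : prefix v w by apply: contra_notT xw; case: rx => _; apply.
have [y ryw /aut_moves[u yu]] := fi_rist_nontrivial w sKG fK.
have wu : prefix w u by apply: contra_notT yu; case: ryw => _; apply.
have ry : rist K v y.
  split=> [|t vt]; first by case: ryw.
  by case: ryw => _; apply; apply: contra vt; apply: prefix_trans.
have actA z : rist K v z ->
    exists2 c, A c & forall t, prefix v t -> c t = z t.
  move=> rz; exists [~ a, z].
    by apply: sgM => //; [apply: sgV | apply: nA => //; case: rz].
  move=> t vt; have [b rb ->] := rist_commutator sK Ka rz.
  rewrite tree_autME (rist_disjoint_fix rb (v := v)) ?aut_size ?(rist_prefix _ rz) //.
  exact: aut_moveV.
have [c Ac cE] := actA x rx; have [e Ae eE] := actA y ry.
have vu := prefix_trans vw wu.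
have : (c * e) u = (e * c) u by rewrite abA.
rewrite !tree_autME (eE u vu) (cE u vu) (cE (y u)) ?(rist_prefix _ ry) //.
rewrite (eE (x u)) ?(rist_prefix _ rx) //.
have -> : y (x u) = x u.
  case: ryw => _; apply; rewrite -{1}(autVK x w) prefix_aut; apply/negP => xwu.
  apply: (@aut_moveV _ x w xw).
  by move: wu xwu; rewrite !prefixE aut_size => /eqP-> /eqP/esym.
by move/aut_inj.
Qed.

(** With [g] in [N] moving [v], the element [[~ g, x]] of [N] is the product of
    [x] and an element [b] that commutes with [y]; so [[~ x, y]] is its
    commutator with [y]. *)
Lemma normal_rist_commutator N v : subgroup_of N G -> normal_in N G ->
  (exists2 g, N g & g v <> v) ->
  forall x y, rist G v x -> rist G v y -> N [~ x, y].
Proof.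
move=> [sN NG] nN [g Ng gv] x y rx ry; have Gg := NG g Ng.
have [b rb Eb] := rist_commutator sG Gg rx.
have Nbx : N (b * x).
  by rewrite -Eb; apply: sgM; [|apply: sgV|apply: nN => //; case: rx].
have cby : commute b y.
  by apply: (rist_commute rb ry); [rewrite aut_size | apply: aut_moveV].
have -> : [~ x, y] = [~ b * x, y].
  rewrite /commg /conjg invgM -!mulgA; congr (_ * _).
  by rewrite [y^-1 * (b * _)]mulgA -(commuteV cby) -mulgA mulKg.
by apply: sgM => //; [apply: sgV | apply: nN => //; case: ry].
Qed.

(** By transitivity on levels, [N] has an element moving any given vertex of
    the level of a vertex moved by some element of [N]. *)
Lemma normal_rist_level_commutators N : subgroup_of N G -> normal_in N G ->
  ~ N `<=` [set 1] -> exists n,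
  forall x y, rist_level G n x -> rist_level G n y -> N [~ x, y].
Proof.
move=> [sN NG] nN ntN; have [trG _ _] := brG.
have [g Ng /aut_moves[v gv]] : exists2 g, N g & g <> 1.
  by apply: contra_notP ntN => nE g Ng; apply: contra_notP nE => g1; exists g.
exists (size v); apply: (gen_commutators sG sN nN).
  by move=> x [u _ []].
move=> x y [u lu rx] [t lt ry]; have [Eut|nut] := pselect (u = t); last first.
  have /commgP/eqP-> := rist_commute rx ry (etrans lu (esym lt)) nut.
  exact: sg1.
subst t; have [h Gh hv] := trG (size v) v u erefl lu.
apply: (normal_rist_commutator (v := u)) => //.
exists (g ^ h^-1); first by apply: nN => //; apply: sgV.
by rewrite /conjg invgK !tree_autME -hv autKV => /aut_inj.
Qed.

(** Modulo the normal subgroup, [rist_level G n] is abelian, finitely generated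
    and torsion. *)
Lemma branch_just_infinite : finitely_generated G ->
  (forall x, G x -> exists2 n, (0 < n)%N & x ^+ n = 1) -> just_infinite G.
Proof.
move=> fgG torG N sNG nN; have [trivN|ntN] := pselect (N `<=` [set 1]).
  by left.
right; have [n comN] := normal_rist_level_commutators sNG nN ntN.
have [sN NG] := sNG; have [_ _ /(_ n) fR] := brG.
set R := rist_level G n in comN fR.
have sR : subgroup R by apply: gen_subgroup.
have RG : R `<=` G by apply: gen_min => // x [u _ []].
have fgR : finitely_generated R by apply: (fg_finite_index _ fgG).
have sNR := sgI sN sR.
suff fNR : finite_index (N `&` R) R.
  by apply: (fi_sup sNR sN _ (fi_trans sNR sR fNR fR)) => x [].
apply: (fi_abelian_torsion fgR).
- by split=> // x [].
- exact: (normalI (normalS RG nN) (normal_self sR)).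
- by move=> x y Rx Ry; split; [exact: comN | exact: (sgR sR)].
- by move=> x /RG/torG[m m0 xm]; exists m => //; rewrite xm; exact: (sg1 sNR).
Qed.

End Branch.

(** * Subgroup induction *)

Section Induction.
Context {d : nat} (G : set (tree_aut d)).
Hypotheses (sG : subgroup G) (fgG : finitely_generated G).
Hypotheses (ssG : self_similar G) (brG : branch G) (indG : subgroup_induction G).
Implicit Types (H K A N : set (tree_aut d)) (g x y a : tree_aut d).
Implicit Types (u v w : seq 'I_d).

Let Gam := stab G (level 1).
Let sGam : subgroup Gam. Proof. by have [] := stab_level1_fi sG. Qed.
Let GamG : Gam `<=` G. Proof. by move=> x []. Qed.

(** The class of the subgroups that are finite if they are virtually abelian is
    inductive.  [G] belongs to it, since an abelian finite-index subgroup [B]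
    would be an abelian normal subgroup of itself.  For a subgroup of the
    first-level stabilizer, an abelian finite-index subgroup is mapped onto
    abelian finite-index subgroups of the sections, which are therefore finite. *)
Lemma virtually_abelian_finite H A : subgroup_of H G -> finitely_generated H ->
  subgroup_of A H -> finite_index A H -> abelian_set A -> finite_set H.
Proof.
pose X := [set H | subgroup_of H G /\ forall A, subgroup_of A H ->
  finite_index A H -> abelian_set A -> finite_set H].
suff indX : inductive_class G X.
  by move=> sH fgH; have [_] := indG indX sH fgH; apply.
split.
- by move=> K [].
- split; split.
  + by split=> [|_ ->]; [exact: sg_set1 | exact: sg1].
  + by move=> B _ _ _; apply: finite_set1.
  + by split.
  + move=> B sBG fB abB; have [sB _] := sBG; apply/(fi_finite sG).
    apply: (fi_sup sB sg_set1) => //.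
    exact: (fi_no_abelian_normal sG brG sBG fB (subgroup_of_refl sB) (normal_self sB) abB).
- move=> K L [sK _] [sL LG] KL fK [_ XK]; split=> // B [sB BL] fB abB.
  have finK : finite_set K.
    apply: (XK (B `&` K)).
    + by split; [exact: sgI | move=> x []].
    + apply: fi_setI => //; last exact: fi_refl.
      exact: fi_mono fB.
    + by move=> x y [Bx _] [By _]; apply: abB.
  apply/(fi_finite sL); apply: (fi_trans sg_set1 sK) => //.
  by apply/(fi_finite sK).
- move=> K [sK KGam] fgK XK; split; first by split=> // x /KGam/GamG.
  move=> B [sB BK] fB abB; apply/(fi_finite sK).
  have /finite_seqP[s Es] := @finite_level d 1.
  have [v sv|] := @fi_bigI _ _ s (fun v => [set x | K x /\ section v x = 1]) K sK.
    have v1 : level 1 v by rewrite Es.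
    have hv : hom_on K (section v) by apply: hom_onS KGam (section_hom v1).
    split; first exact: (hom_preim_subgroup sK hv sg_set1).
    apply: (fi_preim sK hv sg_set1 (G := section v @` K)) => //.
    have simg : subgroup (section v @` K).
      exact: (hom_image_subgroup sK hv (subgroup_of_refl sK)).
    apply/(fi_finite simg); have [_ XKv] := XK v v1.
    apply: (XKv (section v @` B)).
    + split; first exact: (hom_image_subgroup sK hv).
      by move=> _ [x /BK Kx <-]; exists x.
    + by apply: (fi_image sK hv).
    + move=> _ _ [x Bx <-] [y By <-]; have Kx := BK x Bx; have Ky := BK y By.
      by rewrite /commute -(hv x y Kx Ky) -(hv y x Ky Kx) (abB x y).
  move=> sD fD; apply: (fi_sup sD sg_set1) => // x [Kx Dx].
  apply: (sections_trivial (KGam x Kx)) => v; rewrite Es => sv.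
  by have [] := Dx v sv.
Qed.

Lemma sip_torsion x : G x -> exists2 n, (0 < n)%N & x ^+ n = 1.
Proof.
move=> Gx; set C := generated [set x].
have sC : subgroup C by apply: gen_subgroup.
have CG : C `<=` G by apply: gen_min => // _ ->.
have finC : finite_set C.
  apply: (virtually_abelian_finite (conj sC CG) _ (subgroup_of_refl sC) (fi_refl sC)).
    by exists [set x].
  move=> y z Cy Cz; apply/commgP/eqP.
  apply: (@gen_commutators _ G [set 1] [set x]) => //; first exact: sg_set1.
  - by move=> _ g -> _; rewrite conj1g.
  - by move=> _ ->.
  - by move=> _ _ -> ->; rewrite commgg.
have /finite_seqP[s Es] := finC; pose f n := x ^+ n.
have [inj|ninj] := pselect (injective f).
  have : (size (map f (iota 0 (size s).+1)) <= size s)%N.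
    apply: uniq_leq_size; first by rewrite map_inj_uniq // iota_uniq.
    have Cx : C x by apply: gen_sub.
    by move=> _ /mapP[n _ ->]; have := sgX n sC Cx; rewrite Es.
  by rewrite size_map size_iota ltnn.
apply: contrapT => nE; apply: ninj.
have le_inj m n : (m <= n)%N -> f m = f n -> m = n.
  move=> mn E; have [nm|nm] := posnP (n - m)%N.
    by apply/eqP; rewrite eqn_leq mn -subn_eq0 nm.
  exfalso; apply: nE; exists (n - m)%N => //; apply: (mulIg (x ^+ m)).
  by rewrite mul1g -expgnDr subnK.
by move=> m n; have [/le_inj//|/ltnW/le_inj inj E] := leqP m n; rewrite inj.
Qed.

Lemma sip_just_infinite : just_infinite G.
Proof. exact: branch_just_infinite sip_torsion. Qed.

(** Induction on the set of the first-level vertices whose sections are taken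
    into account: [ker r] is the kernel of the sections at the vertices of
    [r]. *)
Lemma sip_separable_stab K N : subgroup_of K Gam ->
  (forall v M, level 1 v -> subgroup_of M (section v @` K) ->
     normal_in M (section v @` K) -> separable G M) ->
  subgroup_of N K -> normal_in N K -> separable Gam N.
Proof.
move=> [sK KGam] sepK sNK nN; have /finite_seqP[s Es] := @finite_level d 1.
pose ker (r : seq (seq 'I_d)) := [set x | Gam x /\ forall v, v \in r -> section v x = 1].
have s1 v : v \in s -> level 1 v by rewrite Es.
have kerS r : {subset r <= s} -> subgroup_of (ker r) Gam /\ normal_in (ker r) Gam.
  move=> rs; split; first split=> [|x []//].
    apply/subgroupP; split.
      by split=> [|v /rs/s1 v1]; [apply: sg1 | apply: (hom_on1 sGam (section_hom v1))].
    move=> x y [Gx kx] [Gy ky]; split=> [|v rv]; first exact: sgF.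
    rewrite (hom_onF sGam (section_hom (s1 v (rs v rv)))) // kx // ky //.
    by rewrite mulgV.
  move=> x g [Gx kx] Gg; split=> [|v rv]; first exact: sgJ.
  by rewrite (hom_onJ sGam (section_hom (s1 v (rs v rv)))) // kx // conj1g.
have sep1 v M : v \in s -> subgroup_of M K -> normal_in M K -> separable Gam (M ** ker [:: v]).
  move=> sv [sM MK] nM; have v1 := s1 v sv; have hv := section_hom (G := G) v1.
  have MGam : M `<=` Gam by move=> x /MK/KGam.
  have -> : M ** ker [:: v] = [set x | Gam x /\ (section v @` M) (section v x)].
    apply/seteqP; split=> x.
      move=> [m Mm [k [Gk kk] <-]]; split; first by apply: sgM => //; apply: MGam.
      exists m => //; rewrite hv //; last exact: MGam.
      by rewrite kk ?mem_head // mulg1.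
    move=> [Gx [m Mm Em]]; exists m => //; exists (m^-1 * x); last exact: mulVKg.
    split; first by apply: sgM => //; apply: sgV => //; apply: MGam.
    move=> _ /[1!inE]/eqP->; rewrite (hom_onVM sGam hv) ?Em ?mulVg //.
    exact: MGam.
  apply: (separable_preim sGam hv (P := G)).
    by move=> _ [x [Gx _] <-]; exact: (@ssG v _ (imageP _ Gx)).
  apply: (sepK v) => //.
    by split; [apply: (hom_image_subgroup sGam hv) | move=> _ [x /MK Kx <-]; exists x].
  exact: (hom_image_normal sGam hv).
have sepr r : {subset r <= s} -> forall M, subgroup_of M K -> normal_in M K ->
    separable Gam (M ** ker r).
  elim: r => [_|v r IHr rs] M sMK nM.
    move=> g Gg [].
    exists 1; first by apply: sg1; case: sMK.
    by exists g => //; rewrite mul1g.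
  have rs' : {subset r <= s} by move=> u ru; apply: rs; rewrite in_cons ru orbT.
  have sv : v \in s by apply: rs; rewrite mem_head.
  have -> : ker (v :: r) = ker [:: v] `&` ker r.
    apply/seteqP; split=> x.
      move=> [Gx kx]; split; split=> // u.
        by rewrite inE => /eqP->; apply: kx; rewrite mem_head.
      by move=> ru; apply: kx; rewrite in_cons ru orbT.
    move=> [[Gx kx] [_ kx']]; split=> // u; rewrite in_cons => /orP[/eqP->|/kx'//].
    by apply: kx; rewrite mem_head.
  have [|sk1 nk1] := kerS [:: v]; first by move=> u /[1!inE]/eqP->.
  have [sk2 nk2] := kerS r rs'.
  apply: (separable_kernelI sGam sk1 nk1 sk2 nk2 (conj sK KGam)) => // L sL nL.
    exact: sep1.
  exact: IHr.
have -> : N = N ** ker s.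
  apply/seteqP; split; first by apply: mulset_l; have [[]] := kerS s (fun _ => id) => /sg1.
  move=> _ [m Mm [k [Gk kk] <-]]; suff -> : k = 1 by rewrite mulg1.
  by apply: (sections_trivial Gk) => v; rewrite Es => /kk.
exact: sepr.
Qed.

(** The class [X] carries all normal subgroups of finite-index subgroups, since
    these are what [separable_kernelI] takes as input. *)
Theorem sip_separable H : subgroup_of H G -> finitely_generated H -> separable G H.
Proof.
pose X := [set H | subgroup_of H G /\ forall K N, subgroup_of K H ->
  finite_index K H -> subgroup_of N K -> normal_in N K -> separable G N].
suff indX : inductive_class G X.
  move=> sH fgH; have [_ XH] := indG indX sH fgH; have [sH' _] := sH.
  have rH := subgroup_of_refl sH'.
  exact: (XH H H rH (fi_refl sH') rH (normal_self sH')).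
have sep1 : separable G [set 1] by apply: residually_finite.
split.
- by move=> K [].
- split; split.
  + by split=> [|_ ->]; [exact: sg_set1 | exact: sg1].
  + move=> K N [_ K1] _ [sN NK] _; suff -> : N = [set 1] by [].
    by apply/seteqP; split=> [x /NK/K1//|_ ->]; apply: sg1.
  + by split.
  + move=> K N sK fK sN nN; apply: (separable_normal_subgroup sG _ _ _ sK) => //.
      exact: sip_just_infinite.
    exact: fi_no_abelian_normal.
- move=> H1 H2 [sH1 _] [sH2 H2G] H12 f12 [_ XH1]; split=> // K N [sK KH] fK [sN NK] nN.
  have sNH := sgI sN sH1.
  apply: (@separable_sup _ G (N `&` H1)) => //.
  + by split=> // x /NK/KH/H2G.
  + apply: (fi_setI sN sH1); first exact: fi_refl.
    by apply: fi_mono f12 => x /NK/KH.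
  + apply: (XH1 (K `&` H1)).
    * by split; [exact: sgI | move=> x []].
    * apply: (fi_setI sK sH1); last exact: fi_refl.
      exact: fi_mono fK.
    * by split=> // x [/NK Kx H1x].
    * apply: normalI; last by apply: normalS (normal_self sH1) => x [].
      by apply: normalS nN => x [].
- move=> H1 [sH1 H1Gam] _ XH1; split; first by split=> // x /H1Gam/GamG.
  move=> K N [sK KH1] fK [sN NK] nN.
  have NGam : N `<=` Gam by move=> x /NK/KH1/H1Gam.
  apply: (@separable_trans _ G Gam) => //.
    by have [] := stab_level1_fi sG.
  apply: (@sip_separable_stab K) => //; first by split=> // x /KH1/H1Gam.
  move=> v M v1 sM nM; have [_ XHv] := XH1 v v1.
  have hv : hom_on H1 (section v) by apply: hom_onS H1Gam (section_hom v1).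
  apply: (XHv (section v @` K)) => //.
    split; first exact: (hom_image_subgroup sH1 hv).
    by move=> _ [x /KH1 Hx <-]; exists x.
  exact: (fi_image sH1 hv).
Qed.

End Induction.

Theorem theorem1p3 (d : nat) (hd : (2 <= d)%N) (G : set (tree_aut d))
    (hG : subgroup G) (hfg : finitely_generated G) (hss : self_similar G)
    (hbr : branch G) (hind : subgroup_induction G) :
  [/\ subgroup_separable G,
      (forall p : nat, is_pgroup p G -> finite_index_frattini G <> [set 1]) &
      (finite_index_frattini G <> [set 1] ->
       forall H : set (tree_aut d), subgroup_of H G -> finitely_generated H ->
         (forall M, maximal_subgroup M H -> finite_index M H) /\
         (forall W, weakly_maximal_subgroup W H -> profinite_closed H W))].
Proof.
have sepG H : subgroup_of H G -> finitely_generated H -> separable G H.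
  exact: sip_separable.
have torG := sip_torsion hG hbr hind.
split.
- by move=> H sH fgH; apply: separable_closed => //; apply: sepG.
- move=> p pG E1; have [p_pr _] := pG.
  have sF := gen_subgroup ([set x ^+ p | x in G] `|` [set [~ x, y] | x in G & y in G]).
  apply: (branch_infinite hbr); apply/(fi_finite hG).
  apply: (fi_sup sF sg_set1) (fi_power_commutators hG hfg p_pr).
  rewrite -E1 => x Fx; split; first exact: power_commutators_sub Fx.
  move=> M maxM fM; have rG := subgroup_of_refl hG.
  have FM := power_commutators_sub_maximal hG rG (normal_self hG) pG maxM fM.
  exact: FM.
- move=> ntPhi.
  have [] := frattini_pgroup hG (residually_finite hG)
    (sip_just_infinite hG hfg hbr hind) (branch_infinite hbr) torG ntPhi.
  have [sN NG] := frattini_subgroup hG; have nN := frattini_normal hG.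
  set N := finite_index_frattini G in sN NG nN * => fN [p [p_pr pN]].
  have maxfi H : subgroup_of H G -> finitely_generated H ->
      forall M, maximal_subgroup M H -> finite_index M H.
    move=> [sH HG] fgH; pose K := H `&` N; have sK : subgroup K by apply: sgI.
    have KH : subgroup_of K H by split=> // x [].
    have fK : finite_index K H.
      by apply: fi_setI => //; [apply: fi_refl | apply: fi_mono fN].
    have pK : is_pgroup p K by split=> // x [_ /pN].
    have nK : normal_in K H by apply: normalI; [apply: normal_self | apply: normalS nN].
    have fgK := fg_finite_index KH fgH fK.
    have sF : subgroup (power_commutators p K) by apply: gen_subgroup.
    apply: (maximal_fi_of_separable (E := power_commutators p K)) => //.
    + exact: fi_trans (fi_power_commutators _ _ _) fK.
    + by move=> M maxM fM; apply: power_commutators_sub_maximal maxM fM.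
    + move=> L [sL LH] fgL; apply: (separable_restrict (conj sH HG)) => //.
      by apply: sepG => //; split=> // x /LH/HG.
  move=> H [sH HG] fgH; split=> [|W wmW]; first exact: maxfi.
  have [sWH _ _] := wmW; apply: separable_closed => //.
  apply: weakly_maximal_separable => // L [sL LH] fgL.
  by apply: maxfi => //; split=> // x /LH/HG.
Qed.
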